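(* Let $n\ge2$ and let $0\ne A\in sp(\mathbb{R}^{2n+2},\Omega')$ satisfy $A^2=\lambda I$ for a constant $\lambda\in\mathbb{R}$, with $\Sigma_A=\{x\in\mathbb{R}^{2n+2}:\Omega'(x,Ax)=1\}$ non-empty. Let $M=\Sigma_A/\{\exp tA\}$ be the quotient manifold, with the symplectic form $\omega$ and connection $\nabla$ obtained by reduction. Then $M$ is a symmetric (symplectic) space and the connection $\nabla$ obtained by reduction is its canonical symmetric connection.
   Context: $\Omega'$ is the standard symplectic structure on $\mathbb{R}^{2n+2}$, $sp(\mathbb{R}^{2n+2},\Omega')$ its symplectic Lie algebra and $\dot\nabla$ the standard flat connection. When $A^2=\lambda I$ the quotient $M$ of $\Sigma_A$ by the flow $\exp tA$ is a manifold (not necessarily connected) and the projection $\pi:\Sigma_A\to M$ is a submersion. For $x\in\Sigma_A$ let $\mathcal H_x=\{v:\Omega'(v,x)=\Omega'(v,Ax)=0\}\subset T_x\Sigma_A$; $\pi_{*x}:\mathcal H_x\to T_{\pi(x)}M$ is an isomorphism, and $\bar X$ denotes the horizontal lift (section of $\mathcal H$) of a vector field $X$ on $M$. The reduced symplectic form and connection on $M$ are $$\omega_{\pi(x)}(X,Y)=\Omega'(\bar X,\bar Y)_x,\qquad \overline{\nabla_XY}(x)=(\dot\nabla_{\bar X}\bar Y)(x)-\Omega'(A\bar X,\bar Y)\,x+\Omega'(\bar X,\bar Y)\,Ax .$$ A symmetric symplectic space is a symplectic manifold $(M,\omega)$ with a smooth family of involutive symplectic diffeomorphisms $s_x$ ($x\in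 M$), the symmetries, such that $x$ is an isolated fixed point of $s_x$ and $s_xs_ys_x=s_{s_x(y)}$; its canonical symmetric connection is the unique linear connection on $M$ for which all the symmetries $s_x$ are affine transformations. *)

(* Defs.v *)
From HB Require Import structures.
From mathcomp Require Import all_boot all_order all_algebra.
From mathcomp Require Import all_classical all_reals all_analysis.

Set Implicit Arguments.
Unset Strict Implicit.
Unset Printing Implicit Defensive.

Import Order.TTheory GRing.Theory Num.Theory.
Import numFieldNormedType.Exports.

Local Open Scope classical_set_scope.
Local Open Scope ring_scope.

Section Calculus.
Context {R : realType} {V W : normedModType R}.

Definition iter_derive (vs : seq V) (f : V -> W) : V -> W :=
  foldr (fun v (g : V -> W) x => 'D_v g x) f vs.

(* On an open set U of a finite-dimensional space this is the class C^oo: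
   all iterated directional derivatives exist and are continuous. *)
Definition Cinfty (U : set V) (f : V -> W) : Prop :=
  forall (vs : seq V) (x : V), U x ->
    {for x, continuous (iter_derive vs f)} /\
    forall v : V, derivable (iter_derive vs f) x v.

(* F is a smooth extension, to a neighbourhood of x in V, of f restricted to
   the (not necessarily open) set S. *)
Definition smooth_ext (S : set V) (f : V -> W) (x : V) (F : V -> W) : Prop :=
  exists U : set V, [/\ open U, U x, Cinfty U F &
                        forall y, U y -> S y -> F y = f y].

Definition smooth_on (S : set V) (f : V -> W) : Prop :=
  forall x, S x -> exists F : V -> W, smooth_ext S f x F.

(* Derivative at x in S, along v tangent to S, of a map f given on S only: it
   is computed on a smooth extension of f, whose choice does not matter when S
   is a submanifold and v is tangent to S at x. *)
Definition derive_on (S : set V) (f : V -> W) (x v : V) : W :=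
  'D_v (xget f [set F | smooth_ext S f x F]) x.

End Calculus.

(* Smooth m-manifolds. The atlas is indexed by the points of the manifold:
   chart p is a chart with domain chart_dom p containing p, and param p is its
   inverse. *)
Record smooth_manifold (R : realType) (m : nat) := SmoothManifold {
  point_of :> topologicalType;
  chart_dom : point_of -> set point_of;
  chart : point_of -> point_of -> 'cV[R]_m;
  param : point_of -> 'cV[R]_m -> point_of;
  pt_hausdorff : hausdorff_space point_of;
  pt_second_countable : @second_countable point_of;
  chart_dom_open : forall p, open (chart_dom p);
  chart_dom_center : forall p, chart_dom p p;
  chart_codom_open : forall p, open (chart p @` chart_dom p);
  chartK : forall p q, chart_dom p q -> param p (chart p q) = q;
  chart_continuous : forall p q, chart_dom p q -> {for q, continuous (chart p)};
  param_continuous : forall p u, (chart p @` chart_dom p) u -> {for u, continuous (param p)};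
  transition_smooth : forall p q,
    smooth_on (chart p @` (chart_dom p `&` chart_dom q))
              (chart q \o param p)
}.

Arguments chart_dom {R m s}.
Arguments chart {R m s}.
Arguments param {R m s}.

Definition chart_codom (R : realType) (m : nat) (M : smooth_manifold R m)
  (p : M) : set 'cV[R]_m := chart p @` chart_dom p.

(* The tangent space T_p M is 'cV[R]_m: a tangent vector at p is given by its
   components in the chosen chart at p. Hence a vector field on M is a function
   M -> 'cV[R]_m whose value at p is expressed in chart p, and the components
   at q have to be moved to one fixed chart before smoothness makes sense. *)
Section Manifolds.
Context {R : realType} {m : nat} (M : smooth_manifold R m).

(* components in chart b of the vector at q with components v in chart a *)
Definition change_chart (a b q : M) (v : 'cV[R]_m) : 'cV[R]_m :=
  'D_v (chart b \o param a) (chart a q).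

(* smooth maps from a subset of a normed space to M *)
Definition smooth_into {V : normedModType R} (S : set V) (f : V -> M) : Prop :=
  forall x, S x ->
    (exists U : set V, [/\ open U, U x &
       forall y, U y -> S y -> chart_dom (f x) (f y)]) /\
    exists F : V -> 'cV[R]_m, smooth_ext S (chart (f x) \o f) x F.

Definition smooth_fun (g : M -> R) : Prop :=
  forall p, smooth_on (chart_codom p) (g \o param p : _ -> R^o).

Definition smooth_vf (X : M -> 'cV[R]_m) : Prop :=
  forall p, smooth_on (chart_codom p)
    (fun u => change_chart (param p u) p (param p u) (X (param p u))).

Definition vf_apply (X : M -> 'cV[R]_m) (g : M -> R) (p : M) : R :=
  'D_(X p) (g \o param p : _ -> R^o) (chart p p).

(* Koszul connections; R-linearity in the second argument is the case of a
   constant function g in the Leibniz rule *)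
Definition is_connection
    (nabla : (M -> 'cV[R]_m) -> (M -> 'cV[R]_m) -> (M -> 'cV[R]_m)) : Prop :=
  [/\ forall X Y, smooth_vf X -> smooth_vf Y -> smooth_vf (nabla X Y),
      forall X X' Y, smooth_vf X -> smooth_vf X' -> smooth_vf Y ->
        forall p, nabla (fun q => X q + X' q) Y p = nabla X Y p + nabla X' Y p,
      forall g X Y, smooth_fun g -> smooth_vf X -> smooth_vf Y ->
        forall p, nabla (fun q => g q *: X q) Y p = g p *: nabla X Y p,
      forall X Y Y', smooth_vf X -> smooth_vf Y -> smooth_vf Y' ->
        forall p, nabla X (fun q => Y q + Y' q) p = nabla X Y p + nabla X Y' p &
      forall g X Y, smooth_fun g -> smooth_vf X -> smooth_vf Y ->
        forall p, nabla X (fun q => g q *: Y q) p =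
                  vf_apply X g p *: Y p + g p *: nabla X Y p].

(* value, at the point with coordinates u in chart p, of the 2-form omega on
   the coordinate fields of chart p with constant components v and w *)
Definition form_in_chart (omega : M -> 'cV[R]_m -> 'cV[R]_m -> R) (p : M)
    (v w : 'cV[R]_m) (u : 'cV[R]_m) : R^o :=
  let q := param p u in
  omega q (change_chart p q q v) (change_chart p q q w).

(* The last condition is d omega = 0, in coordinates. *)
Definition is_symplectic_form
    (omega : M -> 'cV[R]_m -> 'cV[R]_m -> R) : Prop :=
  [/\ forall p a v v' w, omega p (a *: v + v') w = a * omega p v w + omega p v' w,
      forall p v w, omega p v w = - omega p w v,
      forall p v, (forall w, omega p v w = 0) -> v = 0,
      forall p v w, smooth_on (chart_codom p) (form_in_chart omega p v w) &
      forall p v1 v2 v3 u, chart_codom p u ->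
        'D_v1 (form_in_chart omega p v2 v3) u +
        'D_v2 (form_in_chart omega p v3 v1) u +
        'D_v3 (form_in_chart omega p v1 v2) u = 0].

Definition smooth_self_map (f : M -> M) : Prop :=
  forall p, smooth_into (chart_codom p) (f \o param p).

(* the differential T_p M -> T_(f p) M *)
Definition diff_map (f : M -> M) (p : M) (v : 'cV[R]_m) : 'cV[R]_m :=
  'D_v (chart (f p) \o f \o param p) (chart p p).

Definition symplectic_diffeo (omega : M -> 'cV[R]_m -> 'cV[R]_m -> R)
    (f : M -> M) : Prop :=
  [/\ smooth_self_map f,
      exists2 g, smooth_self_map g & cancel f g /\ cancel g f &
      forall p v w, omega (f p) (diff_map f p v) (diff_map f p w) = omega p v w].

Definition vf_related (f : M -> M) (X X' : M -> 'cV[R]_m) : Prop :=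
  forall p, X' (f p) = diff_map f p (X p).

(* for a diffeomorphism f the only X' which is f-related to X is f_* X *)
Definition affine_diffeo
    (nabla : (M -> 'cV[R]_m) -> (M -> 'cV[R]_m) -> (M -> 'cV[R]_m))
    (f : M -> M) : Prop :=
  forall X X' Y Y', smooth_vf X -> smooth_vf X' -> smooth_vf Y -> smooth_vf Y' ->
    vf_related f X X' -> vf_related f Y Y' ->
    vf_related f (nabla X Y) (nabla X' Y').

(* smoothness of (x, y) |-> s x y on M x M, in the product charts *)
Definition smooth_family (s : M -> M -> M) : Prop :=
  forall p q, smooth_into (chart_codom p `*` chart_codom q)
    (fun u : 'cV[R]_m * 'cV[R]_m => s (param p u.1) (param q u.2)).

Definition symmetric_symplectic_space
    (omega : M -> 'cV[R]_m -> 'cV[R]_m -> R) (s : M -> M -> M) : Prop :=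
  is_symplectic_form omega /\
  [/\ smooth_family s,
      forall x, symplectic_diffeo omega (s x),
      forall x, involutive (s x),
      forall x, s x x = x /\
        exists U : set M, [/\ open U, U x & forall y, U y -> s x y = y -> y = x] &
      forall x y z, s x (s y (s x z)) = s (s x y) z].

Definition canonical_symmetric_connection (s : M -> M -> M)
    (nabla : (M -> 'cV[R]_m) -> (M -> 'cV[R]_m) -> (M -> 'cV[R]_m)) : Prop :=
  [/\ is_connection nabla,
      forall x, affine_diffeo nabla (s x) &
      forall nabla', is_connection nabla' ->
        (forall x, affine_diffeo nabla' (s x)) ->
        forall X Y, smooth_vf X -> smooth_vf Y ->
          forall p, nabla' X Y p = nabla X Y p].

End Manifolds.

Section Reduction.
Context {R : realType} {k : nat}.
Notation V := 'cV[R]_(k + k).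

(* the standard symplectic form on R^(2k) *)
Definition Omega (x y : V) : R :=
  (x^T *m block_mx 0 1%:M (- 1%:M) 0 *m y) 0 0.

Definition in_sp (A : 'M[R]_(k + k)) : Prop :=
  forall x y : V, Omega (A *m x) y + Omega x (A *m y) = 0.

Definition expmx (B : 'M[R]_(k + k)) : 'M[R]_(k + k) :=
  limn (series (fun i : nat => (i`!%:R)^-1 *: B ^+ i)).

Definition Sigma (A : 'M[R]_(k + k)) : set V :=
  [set x | Omega x (A *m x) = 1].

(* kernel at x of the differential of the function defining Sigma A *)
Definition tangent_Sigma (A : 'M[R]_(k + k)) (x : V) : set V :=
  [set v | 'D_v (fun y : V => Omega y (A *m y) : R^o) x = 0].

Definition horizontal (A : 'M[R]_(k + k)) (x : V) : set V :=
  [set v | Omega v x = 0 /\ Omega v (A *m x) = 0].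

Context {m : nat} {M : smooth_manifold R m}.

(* The projection is represented by a function on the whole vector space; only
   its values on Sigma A matter. *)
Definition diff_proj (A : 'M[R]_(k + k)) (proj : V -> M) (x v : V) : 'cV[R]_m :=
  derive_on (Sigma A) (chart (proj x) \o proj) x v.

(* proj identifies M with the set of orbits of exp tA in Sigma A, and the
   smooth structure of M is the one which makes proj a submersion *)
Definition quotient_submersion (A : 'M[R]_(k + k)) (proj : V -> M) : Prop :=
  [/\ forall p : M, exists2 x, Sigma A x & proj x = p,
      forall x y, Sigma A x -> Sigma A y ->
        (proj x = proj y <-> exists t : R, y = expmx (t *: A) *m x),
      smooth_into (Sigma A) proj &
      forall x, Sigma A x -> forall w : 'cV[R]_m,
        exists2 v, tangent_Sigma A x v & diff_proj A proj x v = w].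

(* v is the horizontal lift at x of the tangent vector w at proj x *)
Definition horizontal_lift (A : 'M[R]_(k + k)) (proj : V -> M) (x v : V)
    (w : 'cV[R]_m) : Prop :=
  horizontal A x v /\ diff_proj A proj x v = w.

Definition reduced_form (A : 'M[R]_(k + k)) (proj : V -> M)
    (omega : M -> 'cV[R]_m -> 'cV[R]_m -> R) : Prop :=
  forall x v w v' w', Sigma A x ->
    horizontal_lift A proj x v' v -> horizontal_lift A proj x w' w ->
    omega (proj x) v w = Omega v' w'.

Definition reduced_connection (A : 'M[R]_(k + k)) (proj : V -> M)
    (nabla : (M -> 'cV[R]_m) -> (M -> 'cV[R]_m) -> (M -> 'cV[R]_m)) : Prop :=
  forall X Y (X' Y' : V -> V), smooth_vf X -> smooth_vf Y ->
    (forall x, Sigma A x -> horizontal_lift A proj x (X' x) (X (proj x))) ->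
    (forall x, Sigma A x -> horizontal_lift A proj x (Y' x) (Y (proj x))) ->
    forall x, Sigma A x ->
      horizontal_lift A proj x
        (derive_on (Sigma A) Y' x (X' x)
         - Omega (A *m X' x) (Y' x) *: x
         + Omega (X' x) (Y' x) *: (A *m x))
        (nabla X Y (proj x)).

End Reduction.

(* Main.v *)
Require Import Defs.
From HB Require Import structures.
From mathcomp Require Import all_boot all_order all_algebra.
From mathcomp Require Import all_classical all_reals all_analysis.
From mathcomp Require Import ring lra.

(** The quotient is symmetric because each point x of the hypersurface carries
    a linear symmetry upstairs: let S_x be the identity on the plane spanned by x
    and A x and minus the identity on the horizontal space. It preserves Omega
    and commutes with A ([sym_mx_Omega], [sym_mx_A]), hence preserves the
    hypersurface and commutes with the flow; it depends only on the orbit of x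
    ([sym_mx_flow]). So S_x induces on the quotient a map [sym_map], whose
    algebraic properties are identities between such linear maps: [sym_mxK]
    makes it an involution, [sym_mx_conj] gives the conjugation axiom. The flow enters through
    exp (t A) = c(t) + s(t) A with c^2 - lambda s^2 = 1 ([expmx_quadratic],
    [cosA_sinA]).

    The passage between the hypersurface and the quotient rests on smooth local
    sections of the projection ([local_section]). They come from an inverse
    function theorem for smooth maps, which is proved here from the contraction
    principle together with the calculus of C^k maps that it requires. With
    sections, smooth vector fields on the quotient correspond to smooth
    invariant horizontal fields on the hypersurface ([lift_smooth],
    [descend_vf]). The formula for the lift of the reduced connection is built
    from Omega, A and the flat derivative, all of which S_x respects: the
    symmetries are affine ([reduced_affine]).

    For uniqueness, the difference of two connections that the symmetry at p
    preserves is a tensor at p, invariant under minus the identity and bilinear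
    with values in the tangent space, hence zero ([canonical_unique]). That the
    difference is a tensor is usually seen with bump functions; here a
    polynomial identity ([comm_field_complete]) writes a multiple g X of any
    vector field, with g p = 1, as a combination of global fields
    ([frame_decomposition]). *)

Set Implicit Arguments.
Unset Strict Implicit.
Unset Printing Implicit Defensive.
Import Order.TTheory GRing.Theory Num.Theory.
Import numFieldNormedType.Exports.
Local Open Scope classical_set_scope.
Local Open Scope ring_scope.

(** * Directional derivatives *)

Section DirectionalDerivatives.
Context {R : realType}.
Implicit Types E W : normedModType R.

(** For c <> 0 this is the change of variable h |-> c h in the limit of the
    difference quotients. *)
Lemma derivable_scale E W (f : E -> W) (x v : E) (c : R) :
  derivable f x v -> derivable f x (c *: v) /\ 'D_(c *: v) f x = c *: 'D_v f x.
Proof.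
move=> fv; have [->|c0] := eqVneq c 0.
  by rewrite !scale0r derive0; split => //; exact: derivable0.
suff : is_derive x (c *: v) f (c *: 'D_v f x) by move=> [].
suff H : (fun h => h^-1 *: ((f \o shift x) (h *: (c *: v)) - f x)) @ 0^' -->
    c *: 'D_v f x.
  split; last exact: cvg_lim H.
  by apply/cvg_ex; exists (c *: 'D_v f x).
have -> : (fun h => h^-1 *: ((f \o shift x) (h *: (c *: v)) - f x)) =
   (fun h => c *: ((h * c)^-1 *: ((f \o shift x) ((h * c) *: v) - f x))).
  apply/funext => h; rewrite !scalerA; congr (_ *: _).
  have [->|h0] := eqVneq h 0; first by rewrite mul0r invr0 mulr0.
  by rewrite invfM mulrCA mulfV // mulr1.
apply: cvgZl_tmp.
pose q (k : R) := k^-1 *: ((f \o shift x) (k *: v) - f x).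
apply: (@cvg_comp _ _ _ (fun h : R => h * c) q _ (0 : R)^' _ _ fv).
move=> A; rewrite /= !nbhs_simpl /= => -[e /= e0 eA].
exists (e / `|c|) => /=; first by rewrite divr_gt0 // normr_gt0.
move=> h /=; rewrite sub0r normrN ltr_pdivlMr ?normr_gt0 // => he h0.
apply: eA => /=; first by rewrite sub0r normrN normrM.
by rewrite mulf_neq0.
Qed.

Lemma is_derive_line E W (f : E -> W) (a v : E) (s : R) :
  derivable f (a + s *: v) v ->
  is_derive s 1 (fun t : R => f (a + t *: v)) ('D_v f (a + s *: v)).
Proof.
move=> fv.
have eqf : (fun h => h^-1 *: (((fun t : R => f (a + t *: v)) \o shift s) (h *: (1:R))
    - f (a + s *: v))) =
  (fun h => h^-1 *: ((f \o shift (a + s *: v)) (h *: v) - f (a + s *: v))).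
  apply/funext => h /=; congr (_ *: (f _ - _)).
  by rewrite [h *: 1]mulr1 scalerDl addrCA.
by split; rewrite /derivable /derive eqf.
Qed.

(** For scalar functions only: vector-valued maps are treated one coordinate at
    a time, as the intermediate point depends on the coordinate. *)
Lemma mvt_segment E (f : E -> R^o) (a v : E) :
  (forall t, 0 <= t <= 1 -> derivable f (a + t *: v) v) ->
  exists2 c, 0 <= c <= 1 & f (a + v) - f a = 'D_v f (a + c *: v).
Proof.
move=> fv.
have [|||c] := @MVT R (fun t => f (a + t *: v))
   (fun t => 'D_v f (a + t *: v)) 0 1 => //.
- move=> s; rewrite in_itv /= => /andP[s0 s1]; apply: is_derive_line.
  by apply: fv; rewrite !ltW.
- apply: derivable_within_continuous => s; rewrite in_itv /= => s01.
  by have [] := is_derive_line (fv s s01).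
- rewrite in_itv /= => /andP[c0 c1]; rewrite scale1r scale0r addr0 subr0 mulr1.
  by move=> ?; exists c => //; rewrite !ltW.
Qed.

Lemma linear_derive E W (L : {linear E -> W}) (x v : E) :
  derivable L x v /\ 'D_v L x = L v.
Proof.
suff : is_derive x v L (L v) by case.
suff H : (fun h => h^-1 *: ((L \o shift x) (h *: v) - L x)) @ (0 : R)^' --> L v.
  by split; [apply/cvg_ex; exists (L v)|exact: cvg_lim H].
apply: (@cvg_trans _ (cst (L v) @ (0 : R)^')); last exact: cvg_cst.
apply: near_eq_cvg; near=> h.
rewrite /= [L (_ + _)]linearD addrK [L (_ *: _)]linearZ /= scalerA mulVf ?scale1r //.
by near: h; exact: nbhs_dnbhs_neq.
Unshelve. all: by end_near. Qed.

Lemma linear_comp_derive E W W' (L : {linear W -> W'}) (f : E -> W) (x v : E) :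
  continuous L -> derivable f x v ->
  derivable (L \o f) x v /\ 'D_v (L \o f) x = L ('D_v f x).
Proof.
move=> cL fv; suff : is_derive x v (L \o f) (L ('D_v f x)) by case.
suff H : (fun h => h^-1 *: (((L \o f) \o shift x) (h *: v) - (L \o f) x))
    @ (0 : R)^' --> L ('D_v f x).
  by split; [apply/cvg_ex; exists (L ('D_v f x))|exact: cvg_lim H].
have -> : (fun h => h^-1 *: (((L \o f) \o shift x) (h *: v) - (L \o f) x)) =
  L \o (fun h => h^-1 *: ((f \o shift x) (h *: v) - f x)).
  by apply/funext => h /=; rewrite -[L _ - _]linearB -[_ *: L _]linearZ.
apply: continuous_cvg; first exact: cL.
exact: fv.
Qed.

(** Both sides are limits of the same difference quotients; hence equalities
    that hold whether or not these limits exist. *)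
Lemma comp_linear_derive E E' W (L : {linear E' -> E}) (f : E -> W) (x v : E') :
  (derivable (f \o L) x v = derivable f (L x) (L v)) *
  ('D_v (f \o L) x = 'D_(L v) f (L x)).
Proof.
have e : (fun h => h^-1 *: (((f \o L) \o shift x) (h *: v) - (f \o L) x)) =
   (fun h => h^-1 *: ((f \o shift (L x)) (h *: L v) - f (L x))).
  by apply/funext => h /=; rewrite [L (_ + _)]linearD [L (_ *: _)]linearZ.
by split; rewrite /derivable /derive e.
Qed.

End DirectionalDerivatives.

(** * Continuous partial derivatives imply differentiability *)

Section ContinuousPartials.
Context {R : realType} {N : nat}.
Notation V := 'cV[R]_N.

Definition ecol (i : 'I_N) : V := delta_mx i 0.

Lemma cV_decomp (h : V) : h = \sum_i h i 0 *: ecol i.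
Proof.
by rewrite [LHS]matrix_sum_delta; apply: eq_bigr => i _; rewrite big_ord1.
Qed.

Lemma ler_coord (h : V) i : `|h i 0| <= `|h|.
Proof.
by rewrite [leRHS]/Num.Def.normr /= mx_normrE; exact: (le_bigmax _ _ (i, 0)).
Qed.

Lemma ler_cV_norm (h : V) e : 0 <= e -> (forall i, `|h i 0| <= e) -> `|h| <= e.
Proof.
move=> e0 he; rewrite [leLHS]/Num.Def.normr /= mx_normrE.
by apply: bigmax_le => // -[i j] _ /=; rewrite ord1.
Qed.

(** The points head_trunc 0 h, ..., head_trunc N h are the vertices of a broken
    line from 0 to h whose edges are parallel to the axes. *)
Definition head_trunc (k : nat) (h : V) : V := \col_i (if (i < k)%N then h i 0 else 0).

Lemma head_truncS (h : V) (i : 'I_N) : head_trunc i.+1 h = head_trunc i h + h i 0 *: ecol i.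
Proof.
apply/colP => j; rewrite !mxE eqxx andbT ltnS leq_eqVlt -val_eqE /=.
by case: ltngtP => // ?; rewrite ?mulr0 ?addr0 // mulr1 add0r; congr (h _ _); exact: val_inj.
Qed.

End ContinuousPartials.

Section C1.
Context {R : realType}.
Implicit Types E W : normedModType R.

Lemma continuous_sum (T : topologicalType) W (I : Type) (r : seq I)
    (F : I -> T -> W) (x : T) :
  (forall i, {for x, continuous (F i)}) ->
  {for x, continuous (fun y => \sum_(i <- r) F i y)}.
Proof.
move=> cF; elim: r => [|i r IH].
  have -> : (fun y => \sum_(i <- [::]) F i y) = cst 0.
    by apply/funext => y; rewrite big_nil.
  exact: cst_continuous.
have -> : (fun y => \sum_(j <- i :: r) F j y) =
    F i + (fun y => \sum_(j <- r) F j y).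
  by apply/funext => y; rewrite big_cons.
exact: continuousD.
Qed.

Lemma linear_cV_continuous N W (L : {linear 'cV[R]_N -> W}) : continuous L.
Proof.
move=> x; have -> : (L : 'cV[R]_N -> W) =
    (fun h => \sum_i h i 0 *: L (ecol i)).
  apply/funext => h; rewrite {1}[h]cV_decomp linear_sum.
  by apply: eq_bigr => i _; rewrite linearZ.
by apply: continuous_sum => i; apply: continuousZr_tmp; exact: coord_continuous.
Qed.

Lemma differentiable_eps E W (f : E -> W) (L : {linear E -> W}) (a : E) :
  continuous L ->
  (forall e, 0 < e -> \forall h \near 0, `|f (h + a) - (f a + L h)| <= e * `|h|) ->
  differentiable f a.
Proof.
move=> cL H; have key : f \o shift a = cst (f a) + L +o_ 0 id.
  by apply/eqaddoP => _/posnumP[e]; exact: H.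
by apply/diff_locallyP; rewrite (diff_unique cL key).
Qed.

Section differentiable.
Context {N : nat}.
Notation V := 'cV[R]_N.

(** For the sup norm, the broken line does not leave the ball of radius |h|. *)
Lemma head_trunc_seg (h : V) (i : 'I_N) (t : R) : 0 <= t <= 1 ->
  `|head_trunc i h + t *: (h i 0 *: ecol i)| <= `|h|.
Proof.
move=> /andP[t0 t1]; apply: ler_cV_norm => // j.
rewrite !mxE eqxx andbT; apply: le_trans (ler_coord h j).
case: ltngtP => [ji|ij|/val_inj ->].
- by rewrite (_ : (j == i) = false) ?mulr0 ?addr0 // -val_eqE /= ltn_eqF.
- by rewrite (_ : (j == i) = false) ?mulr0 ?addr0 ?normr0 // -val_eqE /= gtn_eqF.
- by rewrite eqxx mulr1 add0r normrM ger0_norm // ler_piMl.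
Qed.

(** The increment g (a + h) - g a telescopes along the broken line of [head_trunc]; on
    each edge the mean value theorem replaces it by a partial derivative at a
    point close to a. *)
Lemma C1_differentiable (g : V -> R^o) (a : V) :
  (\forall y \near a, forall i, derivable g y (ecol i)) ->
  (forall i, {for a, continuous ('D_(ecol i) g)}) ->
  differentiable g a.
Proof.
move=> dg cg.
pose L (h : V) : R^o := \sum_i h i 0 *: 'D_(ecol i) g a.
have Llin : linear L.
  move=> c u v; rewrite /L scaler_sumr -big_split; apply: eq_bigr => i _ /=.
  by rewrite !mxE scalerDl scalerA.
pose LM := GRing.isLinear.Build _ _ _ _ L Llin.
pose LL : {linear V -> R^o} := HB.pack L LM.
have cL : continuous LL by exact: linear_cV_continuous.
apply: (differentiable_eps cL) => _/posnumP[e].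
  have e0 : 0 < e%:num / N.+1%:R by rewrite divr_gt0.
  have : \forall y \near a, (forall i, derivable g y (ecol i)) /\
      forall i, `|'D_(ecol i) g a - 'D_(ecol i) g y| <= e%:num / N.+1%:R.
    near=> y; split; first by near: y.
    near: y; apply: filter_forall => i.
    by move/cvgrPdist_le : (cg i) => /(_ _ e0).
  move=> /nbhs_ballP[r /= r0 Hr].
  apply/nbhs_ballP; exists r => //= h; rewrite -ball_normE /= sub0r normrN => hr.
  have segr (i : 'I_N) (t : R) : 0 <= t <= 1 -> ball a r (a + head_trunc i h + t *: (h i 0 *: ecol i)).
    move=> t01; rewrite -ball_normE /= -addrA opprD addNKr normrN.
    by apply: le_lt_trans hr; exact: head_trunc_seg.
  have tel : g (h + a) - g a =
      \sum_(i < N) (g (a + head_trunc i.+1 h) - g (a + head_trunc i h)).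
    rewrite -(big_mkord xpredT (fun i => g (a + head_trunc i.+1 h) - g (a + head_trunc i h))).
    rewrite telescope_sumr //.
    have -> : head_trunc 0 h = 0 by apply/colP => j; rewrite !mxE.
    have -> : head_trunc N h = h by apply/colP => j; rewrite !mxE ltn_ord.
    by rewrite addr0 [h + a]addrC.
  have -> : g (h + a) - (g a + LL h) = \sum_(i < N)
      (g (a + head_trunc i.+1 h) - g (a + head_trunc i h) - h i 0 *: 'D_(ecol i) g a).
    by rewrite sumrB -tel opprD addrA.
  apply: (@le_trans _ _ (\sum_(i < N) e%:num / N.+1%:R * `|h|)).
    apply: le_trans (ler_norm_sum _ _ _) _; apply: ler_sum => i _.
    rewrite head_truncS addrA.
    have dseg t : 0 <= t <= 1 ->
        derivable g (a + head_trunc i h + t *: (h i 0 *: ecol i)) (ecol i).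
      by move=> t01; have [+ _] := Hr _ (segr i t t01); exact.
    have [t t01 ->] := mvt_segment
      (fun t t01 => (derivable_scale (h i 0) (dseg t t01)).1).
    rewrite (derivable_scale (h i 0) (dseg t t01)).2 -scalerBr normrM mulrC.
    apply: ler_pM => //; last exact: ler_coord.
    rewrite distrC; have [_ +] := Hr _ (segr i t t01); exact.
  rewrite sumr_const card_ord -[_ *+ N]mulr_natl mulrA ler_wpM2r //.
  rewrite mulrCA ger_pMr // ler_pdivrMr // mul1r ler_nat //.
Unshelve. all: by end_near. Qed.

End differentiable.

(** Only the restriction of f to a line enters, so the domain of f may be any
    normed space, such as a product of two charts. *)
Lemma derive_comp_diff E N (W : normedModType R) (f : E -> 'cV[R]_N) (g : 'cV[R]_N -> W) (x v : E) :
  derivable f x v -> differentiable g (f x) ->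
  derivable (g \o f) x v /\ 'D_v (g \o f) x = 'D_('D_v f x) g (f x).
Proof.
move=> dfx dg.
pose l (t : R) := f (x + t *: v).
have l0 : l 0 = f x by rewrite /l scale0r addr0.
have dl0 : derivable f (x + 0 *: v) v by rewrite scale0r addr0.
have [dl el] := is_derive_line dl0; rewrite scale0r addr0 in el.
have dl' : differentiable l 0 by apply/derivable1_diffP.
have dg' : differentiable g (l 0) by rewrite l0.
have dgl : differentiable (g \o l) 0 by exact: differentiable_comp.
have E1 : (fun h : R => h^-1 *: (((g \o f) \o shift x) (h *: v) - (g \o f) x)) =
  (fun h => h^-1 *: (((g \o l) \o shift 0) (h *: (1:R)) - (g \o l) 0)).
  apply/funext => h /=; rewrite l0 addr0 /l [h *: (1:R)]mulr1.
  by rewrite [x + _]addrC.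
have -> : derivable (g \o f) x v = derivable (g \o l) 0 1 by rewrite /derivable E1.
have -> : 'D_v (g \o f) x = 'D_1 (g \o l) 0 by rewrite /derive E1.
split; first exact/derivable1_diffP.
rewrite deriveE // diff_comp //= -(deriveE _ dl') el.
by rewrite l0 -deriveE.
Qed.

Lemma diff_derive_sum N (W : normedModType R) (g : 'cV[R]_N -> W) (y w : 'cV[R]_N) :
  differentiable g y -> 'D_w g y = \sum_i w i 0 *: 'D_(ecol i) g y.
Proof.
move=> dg; rewrite deriveE // {1}[w]cV_decomp linear_sum.
by apply: eq_bigr => i _; rewrite linearZ deriveE.
Qed.

End C1.

(** * Maps of class C^k *)

Section CkClass.
Context {R : realType}.
Implicit Types E W : normedModType R.

(** The derivative in the direction v is taken first, so that a proof by
    induction on k only has to compute first derivatives. *)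
Fixpoint Ck {E W} (k : nat) (U : set E) (f : E -> W) : Prop :=
  (forall x, U x -> {for x, continuous f}) /\
  (if k is k'.+1 then
     forall v, (forall x, U x -> derivable f x v) /\ Ck k' U ('D_v f)
   else True).

Lemma Ck_cont E W k (U : set E) (f : E -> W) x :
  Ck k U f -> U x -> {for x, continuous f}.
Proof. by case: k => [|k] [+ _]; exact. Qed.

Lemma Ck_derivable E W k (U : set E) (f : E -> W) x v :
  Ck k.+1 U f -> U x -> derivable f x v.
Proof. by case=> _ /(_ v) [+ _]; exact. Qed.

Lemma Ck_derive E W k (U : set E) (f : E -> W) v :
  Ck k.+1 U f -> Ck k U ('D_v f).
Proof. by case=> _ /(_ v) []. Qed.

Arguments Ck_derivable {E W k U f x} v.
Arguments Ck_derive {E W k U f} v.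

Lemma CkS E W k (U : set E) (f : E -> W) : Ck k.+1 U f -> Ck k U f.
Proof.
elim: k f => [|k IH] f; first by case.
by move=> [cf df]; split => // v; have [? ?] := df v; split => //; exact: IH.
Qed.

Lemma iter_derive_rcons E W (vs : seq E) v (f : E -> W) :
  iter_derive (rcons vs v) f = iter_derive vs ('D_v f).
Proof. by rewrite /iter_derive foldr_rcons. Qed.

Lemma Cinfty_Ck E W (U : set E) (f : E -> W) : Cinfty U f <-> forall k, Ck k U f.
Proof.
split => [+ k|].
  elim: k f => [|k IH] f Cf; first by split => // x Ux; have [] := Cf [::] x Ux.
  split => [x Ux|v]; first by have [] := Cf [::] x Ux.
  split => [x Ux|]; first by have [_ +] := Cf [::] x Ux; exact.
  by apply: IH => vs x Ux; have := Cf (rcons vs v) x Ux; rewrite iter_derive_rcons.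
(* [iter_derive] applies the last vector of the list first *)
move=> Cf vs; elim/last_ind: vs f Cf => [|vs v IH] f Cf x Ux.
  by split => [|v]; [exact: Ck_cont (Cf 0%N) Ux|exact: Ck_derivable _ (Cf 1%N) Ux].
by rewrite iter_derive_rcons; apply: IH => // k; exact: Ck_derive _ (Cf k.+1).
Qed.

Lemma Ck_sub E W k (U U' : set E) (f : E -> W) : U' `<=` U -> Ck k U f -> Ck k U' f.
Proof.
move=> UU'; elim: k f => [|k IH] f [cf df]; split => //.
- by move=> x /UU'; exact: cf.
- by move=> x /UU'; exact: cf.
by move=> v; have [? ?] := df v; split; [move=> x /UU'; auto|exact: IH].
Qed.

Lemma open_near (T : topologicalType) (U : set T) (P : T -> Prop) x :
  open U -> U x -> (forall y, U y -> P y) -> \forall y \near x, P y.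
Proof. by move=> oU Ux HP; apply: filterS HP _; exact: open_nbhs_nbhs. Qed.

Lemma eq_Ck E W k (U : set E) (f g : E -> W) : open U ->
  (forall x, U x -> f x = g x) -> Ck k U f -> Ck k U g.
Proof.
move=> oU; elim: k f g => [|k IH] f g fg [cf df].
  split => // x Ux; have := cf x Ux; rewrite /prop_for /continuous_at (fg x Ux).
  by apply: cvg_trans; apply: near_eq_cvg; exact: open_near fg.
split => [x Ux|v].
  have := cf x Ux; rewrite /prop_for /continuous_at (fg x Ux).
  by apply: cvg_trans; apply: near_eq_cvg; exact: open_near fg.
have [d1 d2] := df v; split => [x Ux|].
  by apply: near_eq_derivable (d1 x Ux); exact: open_near fg.
apply: IH d2 => x Ux; apply: near_eq_derive; exact: open_near fg.
Qed.

(** The common shape of the closure proofs: the derivatives are given by a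
    formula to which the induction hypothesis applies. *)
Lemma Ck_of_derive E W k (U : set E) (f : E -> W) (df : E -> E -> W) :
  open U -> (forall x, U x -> {for x, continuous f}) ->
  (forall x v, U x -> derivable f x v /\ 'D_v f x = df v x) ->
  (forall v, Ck k U (df v)) -> Ck k.+1 U f.
Proof.
move=> oU cf Hd Hk; split => // v; split => [x Ux|]; first by have [] := Hd x v Ux.
by apply: eq_Ck (Hk v) => // x Ux; have [_ ->] := Hd x v Ux.
Qed.

Lemma Ck_cst E W k (U : set E) (c : W) : open U -> Ck k U (cst c).
Proof.
move=> oU; elim: k c => [|k IH] c.
  by split => // x _; exact: cst_continuous.
apply: (@Ck_of_derive _ _ _ _ _ (fun _ => cst 0)) => //.
  by move=> x _; exact: cst_continuous.
by move=> x v _; split; [exact: derivable_cst|rewrite derive_cst].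
Qed.

Lemma Ck_linear E W k (U : set E) (L : {linear E -> W}) :
  open U -> continuous L -> Ck k U L.
Proof.
move=> oU cL; case: k => [|k]; first by split => // x _; exact: cL.
apply: (@Ck_of_derive _ _ _ _ _ (fun v => cst (L v))) => //.
- by move=> x _; exact: cL.
- by move=> x v _; exact: linear_derive.
- by move=> v; exact: Ck_cst.
Qed.

Lemma CkD E W k (U : set E) (f g : E -> W) : open U ->
  Ck k U f -> Ck k U g -> Ck k U (f + g).
Proof.
move=> oU; elim: k f g => [|k IH] f g Cf Cg.
  by split => // x Ux; apply: continuousD; [exact: Ck_cont Cf Ux|exact: Ck_cont Cg Ux].
apply: (@Ck_of_derive _ _ _ _ _ (fun v => 'D_v f + 'D_v g)) => //.
- by move=> x Ux; apply: continuousD; [exact: Ck_cont Cf Ux|exact: Ck_cont Cg Ux].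
- move=> x v Ux; have df := Ck_derivable v Cf Ux; have dg := Ck_derivable v Cg Ux.
  by split; [exact: derivableD|rewrite deriveD].
- by move=> v; apply: IH; exact: Ck_derive.
Qed.

Lemma CkM E k (U : set E) (f g : E -> R^o) : open U ->
  Ck k U f -> Ck k U g -> Ck k U (fun x => f x * g x : R^o).
Proof.
move=> oU; elim: k f g => [|k IH] f g Cf Cg.
  by split => // x Ux; apply: continuousM; [exact: Ck_cont Cf Ux|exact: Ck_cont Cg Ux].
apply: (@Ck_of_derive _ _ _ _ _
   (fun v => (fun x => f x * 'D_v g x : R^o) + (fun x => g x * 'D_v f x : R^o))) => //.
- by move=> x Ux; apply: continuousM; [exact: Ck_cont Cf Ux|exact: Ck_cont Cg Ux].
- move=> x v Ux; have df := Ck_derivable v Cf Ux; have dg := Ck_derivable v Cg Ux.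
  by split; [exact: (derivableM df dg)|exact: (deriveM df dg)].
- move=> v; apply: CkD => //; apply: IH; try exact: Ck_derive; exact: CkS.
Qed.

Lemma Ck_comp_linear E E' W k (U : set E) (L : {linear E' -> E}) (f : E -> W) :
  open U -> continuous L -> Ck k U f -> Ck k (L @^-1` U) (f \o L).
Proof.
move=> oU cL; have oU' : open (L @^-1` U) by apply: open_comp => // x _; exact: cL.
elim: k f => [|k IH] f Cf.
  split => // x Ux; apply: continuous_comp; [exact: cL|exact: Ck_cont Cf Ux].
apply: (@Ck_of_derive _ _ _ _ _ (fun v => 'D_(L v) f \o L)) => //.
- move=> x Ux; apply: continuous_comp; [exact: cL|exact: Ck_cont Cf Ux].
- move=> x v Ux; rewrite !comp_linear_derive; split => //.
  exact: Ck_derivable _ Cf Ux.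
- by move=> v; apply: IH; exact: Ck_derive.
Qed.

Lemma Ck_mx E m n k (U : set E) (f : E -> 'M[R]_(m, n)) : open U ->
  (Ck k U f <-> forall i j, Ck k U (fun x => f x i j : R^o)).
Proof.
move=> oU; have cE (g : E -> 'M[R]_(m, n)) :
  (forall x, U x -> {for x, continuous g}) <->
  (forall i j x, U x -> {for x, continuous (fun y => g y i j : R^o)}).
  split => [cg i j x Ux|cg x Ux].
    apply: (@continuous_comp _ _ _ g (fun M : 'M[R]_(m, n) => M i j)).
      exact: cg.
    exact: coord_continuous.
  apply/cvgrPdist_le => /= e e0.
  have : \forall y \near x, forall ij : 'I_m * 'I_n,
      `|g x ij.1 ij.2 - g y ij.1 ij.2| <= e.
    apply: filter_forall => -[i j] /=.
    by move/cvgrPdist_le : (cg i j x Ux) => /(_ _ e0).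
  apply: filterS => y Hy.
  rewrite [leLHS]/Num.Def.normr /= mx_normrE; apply: bigmax_le; first exact: ltW.
  by move=> ij _; rewrite !mxE.
elim: k f => [|k IH] f.
  by split=> [[/cE cf _] i j|cf]; split => //; [exact: cf|apply/cE => i j; have [] := cf i j].
split=> [Cf i j|Cf].
  apply: (@Ck_of_derive _ _ _ _ _ (fun v x => 'D_v f x i j : R^o)) => //.
  - by have [/cE cf _] := Cf; exact: cf.
  - move=> x v Ux; have df := Ck_derivable v Cf Ux.
    split; first by have /derivable_mxP := df; exact.
    by rewrite derive_mx // mxE.
  - by move=> v; have /IH := Ck_derive v Cf; exact.
have dd x v : U x -> derivable f x v.
  by move=> Ux; apply/derivable_mxP => i j; exact: Ck_derivable _ (Cf i j) Ux.
apply: (@Ck_of_derive _ _ _ _ _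
   (fun v x => \matrix_(i, j) ('D_v (fun y => f y i j : R^o) x))) => //.
- by apply/cE => i j x Ux; exact: Ck_cont (Cf i j) Ux.
- by move=> x v Ux; split; [exact: dd|rewrite derive_mx //; exact: dd].
- move=> v; apply/IH => i j.
  apply: eq_Ck (Ck_derive v (Cf i j)) => // x Ux.
  by rewrite mxE.
Qed.

Lemma Ck_sum E W k (U : set E) I (r : seq I) (F : I -> E -> W) : open U ->
  (forall i, Ck k U (F i)) -> Ck k U (fun x => \sum_(i <- r) F i x).
Proof.
move=> oU CF; elim: r => [|i r IH].
  have -> : (fun x => \sum_(i <- [::]) F i x) = cst 0.
    by apply/funext => y; rewrite big_nil.
  exact: Ck_cst.
have -> : (fun y => \sum_(j <- i :: r) F j y) = F i + (fun y => \sum_(j <- r) F j y).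
  by apply/funext => y; rewrite big_cons.
exact: CkD.
Qed.

Lemma Ck_prod E k (U : set E) I (r : seq I) (F : I -> E -> R^o) : open U ->
  (forall i, Ck k U (F i)) -> Ck k U (fun x => \prod_(i <- r) F i x : R^o).
Proof.
move=> oU CF; elim: r => [|i r IH].
  have -> : (fun x => \prod_(i <- [::]) F i x : R^o) = cst 1.
    by apply/funext => y; rewrite big_nil.
  exact: Ck_cst.
have -> : (fun y => \prod_(j <- i :: r) F j y : R^o) =
    (fun y => F i y * \prod_(j <- r) F j y).
  by apply/funext => y; rewrite big_cons.
exact: CkM.
Qed.

Lemma CkV E k (U : set E) (f : E -> R^o) : open U ->
  (forall x, U x -> f x != 0) -> Ck k U f -> Ck k U (fun x => (f x)^-1 : R^o).
Proof.
move=> oU f0; elim: k f f0 => [|k IH] f f0 Cf.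
  by split => // x Ux; apply: continuousV; [exact: f0|exact: Ck_cont Cf Ux].
have CV := IH f f0 (CkS Cf).
apply: (@Ck_of_derive _ _ _ _ _
   (fun v x => (-1) * ((f x)^-1 * (f x)^-1) * 'D_v f x : R^o)) => //.
- by move=> x Ux; apply: continuousV; [exact: f0|exact: Ck_cont Cf Ux].
- move=> x v Ux; have df := Ck_derivable v Cf Ux.
  split; first by apply: derivableV => //; exact: f0.
  rewrite deriveV //; last exact: f0.
  by rewrite expr2 invfM mulN1r.
- move=> v; apply: CkM => //; last exact: Ck_derive.
  by apply: CkM => //; [exact: Ck_cst|exact: CkM].
Qed.

Lemma Ck_differentiable N k (U : set 'cV[R]_N) (g : 'cV[R]_N -> R^o) x :
  open U -> Ck k.+1 U g -> U x -> differentiable g x.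
Proof.
move=> oU Cg Ux; apply: C1_differentiable.
  by apply: open_near oU Ux _ => y Uy i; exact: Ck_derivable _ Cg Uy.
by move=> i; exact: Ck_cont (Ck_derive (ecol i) Cg) Ux.
Qed.

(** By the chain rule D_v (g o f) is a sum of products of coordinates of D_v f
    with partial derivatives of g composed with f. *)
Lemma Ck_comp E N k (U : set E) (U' : set 'cV[R]_N) (f : E -> 'cV[R]_N)
    (g : 'cV[R]_N -> R^o) :
  open U -> open U' -> (forall x, U x -> U' (f x)) ->
  Ck k U f -> Ck k U' g -> Ck k U (g \o f).
Proof.
move=> oU oU' UU'; elim: k g => [|k IH] g Cf Cg.
  by split => // x Ux; apply: continuous_comp; [exact: Ck_cont Cf Ux|exact: Ck_cont Cg (UU' _ Ux)].
apply: (@Ck_of_derive _ _ _ _ _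
   (fun v x => \sum_(i < N) ('D_v f x i 0 : R^o) * ('D_(ecol i) g (f x)) : R^o)) => //.
- by move=> x Ux; apply: continuous_comp; [exact: Ck_cont Cf Ux|exact: Ck_cont Cg (UU' _ Ux)].
- move=> x v Ux; have dg := Ck_differentiable oU' Cg (UU' _ Ux).
  have [d1 d2] := derive_comp_diff (Ck_derivable v Cf Ux) dg.
  by split => //; rewrite d2 diff_derive_sum.
- move=> v; apply: Ck_sum => // i; apply: CkM => //.
    by have /(Ck_mx _ _ oU) := Ck_derive v Cf; exact.
  exact: (IH _ (CkS Cf) (Ck_derive _ Cg)).
Qed.

Lemma Ck_comp_mx E N m n k (U : set E) (U' : set 'cV[R]_N) (f : E -> 'cV[R]_N)
    (g : 'cV[R]_N -> 'M[R]_(m, n)) :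
  open U -> open U' -> (forall x, U x -> U' (f x)) ->
  Ck k U f -> Ck k U' g -> Ck k U (g \o f).
Proof.
move=> oU oU' UU' Cf /(Ck_mx _ _ oU') Cg; apply/Ck_mx => // i j.
exact: (Ck_comp oU oU' UU' Cf (Cg i j)).
Qed.

Lemma Ck_mulmx E m n p k (U : set E) (f : E -> 'M[R]_(m, n)) (g : E -> 'M[R]_(n, p)) :
  open U -> Ck k U f -> Ck k U g -> Ck k U (fun x => f x *m g x).
Proof.
move=> oU /(Ck_mx _ _ oU) Cf /(Ck_mx _ _ oU) Cg; apply/Ck_mx => // i j.
have -> : (fun x => (f x *m g x) i j : R^o) =
    (fun x => \sum_l (f x i l : R^o) * (g x l j : R^o) : R^o).
  by apply/funext => x; rewrite mxE.
by apply: Ck_sum => // l; apply: CkM.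
Qed.

Lemma Ck_det E n k (U : set E) (f : E -> 'M[R]_n) :
  open U -> Ck k U f -> Ck k U (fun x => \det (f x) : R^o).
Proof.
move=> oU /(Ck_mx _ _ oU) Cf; apply: Ck_sum => // s; apply: CkM => //.
  exact: Ck_cst.
exact: Ck_prod.
Qed.

(** Cramer's formula: the entries are quotients of polynomials in those of f. *)
Lemma Ck_invmx E n k (U : set E) (f : E -> 'M[R]_n) :
  open U -> (forall x, U x -> f x \in unitmx) ->
  Ck k U f -> Ck k U (fun x => invmx (f x)).
Proof.
move=> oU fU Cf; have Cf' := Cf; move/(Ck_mx _ _ oU): Cf => Cf; apply/Ck_mx => // i j.
apply: (@eq_Ck _ _ _ _
  (fun x => (\det (f x))^-1 * ((-1) ^+ (j + i) * \det (row' j (col' i (f x)))) : R^o)) => //.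
  by move=> x Ux; rewrite /invmx fU // !mxE.
apply: CkM => //.
  apply: CkV => //; last exact: Ck_det.
  by move=> x /fU; rewrite unitmxE unitfE.
apply: CkM => //; first exact: Ck_cst.
apply: Ck_det => //; apply/Ck_mx => // i' j'.
apply: (@eq_Ck _ _ _ _ (fun x => f x (lift j i') (lift i j') : R^o)) => //.
by move=> x Ux; rewrite !mxE.
Qed.

End CkClass.

(** * Germs of smooth maps *)

Section SmoothAt.
Context {R : realType}.
Implicit Types E W : normedModType R.

(** One neighbourhood serves all derivatives, as in [Cinfty]. *)
Definition smoothat {E W} (f : E -> W) (x : E) : Prop :=
  exists U : set E, [/\ open U, U x & Cinfty U f].

Lemma smoothat_near E W (f : E -> W) x :
  smoothat f x -> \forall y \near x, smoothat f y.
Proof.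
by move=> [U [oU Ux Cf]]; apply: (open_near oU Ux) => y Uy; exists U.
Qed.

Lemma near_open (T : topologicalType) (P : T -> Prop) (x : T) :
  (\forall y \near x, P y) -> exists U : set T, [/\ open U, U x & U `<=` P].
Proof.
move=> H; have {H} : nbhs x P by exact: H.
rewrite nbhsE.
move=> -[U [oU Ux] UP]; exists U; split => //.
Qed.

Lemma smoothat_eq E W (f g : E -> W) x :
  (\forall y \near x, f y = g y) -> smoothat f x -> smoothat g x.
Proof.
move=> /near_open[U [oU Ux Ufg]] [U' [oU' Ux' /Cinfty_Ck Cf]].
exists (U `&` U'); split; [exact: openI|by []|].
apply/Cinfty_Ck => k; apply: (@eq_Ck _ _ _ _ _ f).
- exact: openI.
- by move=> y [/Ufg].
- by apply: Ck_sub (Cf k) => y [].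
Qed.

Lemma smoothat2 E W W' W'' (f : E -> W) (g : E -> W') (h : E -> W'') x :
  (forall U k, open U -> Ck k U f -> Ck k U g -> Ck k U h) ->
  smoothat f x -> smoothat g x -> smoothat h x.
Proof.
move=> H [U [oU Ux /Cinfty_Ck Cf]] [U' [oU' Ux' /Cinfty_Ck Cg]].
exists (U `&` U'); split; [exact: openI|by []|].
apply/Cinfty_Ck => k; apply: H; first exact: openI.
- by apply: Ck_sub (Cf k) => y [].
- by apply: Ck_sub (Cg k) => y [].
Qed.

Lemma smoothat1 E W W' (f : E -> W) (h : E -> W') x :
  (forall U k, open U -> Ck k U f -> Ck k U h) -> smoothat f x -> smoothat h x.
Proof. by move=> H sf; apply: (@smoothat2 _ _ _ _ f f) => // U k oU Cf _; exact: H. Qed.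

Lemma smoothat_cst E W (c : W) (x : E) : smoothat (cst c) x.
Proof.
exists setT; split => //; first exact: openT.
by apply/Cinfty_Ck => k; apply: Ck_cst; exact: openT.
Qed.

Lemma smoothat_linear E W (L : {linear E -> W}) (x : E) :
  continuous L -> smoothat L x.
Proof.
exists setT; split => //; first exact: openT.
by apply/Cinfty_Ck => k; apply: Ck_linear => //; exact: openT.
Qed.

Lemma smoothatD E W (f g : E -> W) x :
  smoothat f x -> smoothat g x -> smoothat (f + g) x.
Proof. by apply: smoothat2 => U k oU; exact: CkD. Qed.

Lemma smoothatM E (f g : E -> R^o) x :
  smoothat f x -> smoothat g x -> smoothat (fun y => f y * g y : R^o) x.
Proof. by apply: smoothat2 => U k oU; exact: CkM. Qed.

Lemma smoothat_mulmx E m n p (f : E -> 'M[R]_(m, n)) (g : E -> 'M[R]_(n, p)) x :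
  smoothat f x -> smoothat g x -> smoothat (fun y => f y *m g y) x.
Proof. by apply: smoothat2 => U k oU; exact: Ck_mulmx. Qed.

Lemma smoothat_comp_linear E E' W (L : {linear E' -> E}) (f : E -> W) x :
  continuous L -> smoothat f (L x) -> smoothat (f \o L) x.
Proof.
move=> cL [U [oU Ux /Cinfty_Ck Cf]]; exists (L @^-1` U); split => //.
  by apply: open_comp => // y _; exact: cL.
by apply/Cinfty_Ck => k; exact: Ck_comp_linear.
Qed.

Lemma smoothat_entry E m n (f : E -> 'M[R]_(m, n)) x i j :
  smoothat f x -> smoothat (fun y => f y i j : R^o) x.
Proof. by apply: smoothat1 => U k oU /(Ck_mx _ _ oU); exact. Qed.

(** What turns entrywise smoothness of matrices into smoothness: finitely many
    germs live on a common neighbourhood. *)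
Lemma smoothat_all E W (I : finType) (f : I -> E -> W) x :
  (forall i, smoothat (f i) x) ->
  exists U, [/\ open U, U x & forall i, Cinfty U (f i)].
Proof.
move=> sf; have [U HU] := choice sf.
have [|V [oV Vx VU]] := @near_open E (fun y => forall i, U i y) x.
  by apply: filter_forall => i; have [oU Ux _] := HU i; apply: open_nbhs_nbhs.
exists V; split => // i; have [_ _ /Cinfty_Ck Cf] := HU i.
by apply/Cinfty_Ck => k; apply: Ck_sub (Cf k) => y /VU; exact.
Qed.

Lemma smoothat_mx E m n (f : E -> 'M[R]_(m, n)) x :
  (forall i j, smoothat (fun y => f y i j : R^o) x) -> smoothat f x.
Proof.
move=> sf; have [|U [oU Ux Cf]] :=
  @smoothat_all E R^o ('I_m * 'I_n)%type (fun ij y => f y ij.1 ij.2) x.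
  by move=> ij; exact: sf.
exists U; split => //; apply/Cinfty_Ck => k; apply/Ck_mx => // i j.
by have /Cinfty_Ck := Cf (i, j); exact.
Qed.

Lemma smoothat_continuous E W (f : E -> W) x : smoothat f x -> {for x, continuous f}.
Proof. by move=> [U [oU Ux /Cinfty_Ck /(_ 0%N) Cf]]; exact: Ck_cont Cf Ux. Qed.

Lemma smoothat_derivable E W (f : E -> W) x v : smoothat f x -> derivable f x v.
Proof. by move=> [U [oU Ux /Cinfty_Ck /(_ 1%N) Cf]]; exact: Ck_derivable Cf Ux. Qed.

Lemma smoothat_derive E W (f : E -> W) x v : smoothat f x -> smoothat ('D_v f) x.
Proof.
move=> [U [oU Ux /Cinfty_Ck Cf]]; exists U; split => //; apply/Cinfty_Ck => k.
exact: Ck_derive (Cf k.+1).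
Qed.

Lemma unitmx_near E n (f : E -> 'M[R]_n) x :
  smoothat f x -> f x \in unitmx -> \forall y \near x, f y \in unitmx.
Proof.
move=> [U [oU Ux /Cinfty_Ck Cf]] fU.
have cdet : {for x, continuous (fun y => \det (f y) : R^o)}.
  exact: Ck_cont (Ck_det oU (Cf 0%N)) Ux.
have : \forall y \near x, \det (f y) != 0.
  apply: (cdet [set t | t != 0]); apply: open_nbhs_nbhs; split.
    exact: open_neq.
  by rewrite /= -unitfE -unitmxE.
by apply: filterS => y; rewrite unitmxE unitfE.
Qed.

Lemma smoothat_invmx E n (f : E -> 'M[R]_n) x :
  f x \in unitmx -> smoothat f x -> smoothat (fun y => invmx (f y)) x.
Proof.
move=> fxU sf; have := sf => -[U [oU Ux /Cinfty_Ck Cf]].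
have /near_open[U' [oU' Ux' U'f]] := unitmx_near sf fxU.
exists (U `&` U'); split => //.
  exact: openI.
apply/Cinfty_Ck => k; apply: Ck_invmx.
- exact: openI.
- by move=> y [_ /U'f].
- by apply: Ck_sub (Cf k) => y [].
Qed.

Lemma smoothat_comp E N m n (f : E -> 'cV[R]_N) (g : 'cV[R]_N -> 'M[R]_(m, n)) x :
  smoothat f x -> smoothat g (f x) -> smoothat (g \o f) x.
Proof.
move=> sf [U' [oU' U'fx /Cinfty_Ck Cg]].
have := smoothat_continuous sf => cf.
have /near_open[U1 [oU1 U1x U1f]] : \forall y \near x, U' (f y).
  exact: (cf U' (open_nbhs_nbhs (conj oU' U'fx))).
move: sf => [U [oU Ux /Cinfty_Ck Cf]].
exists (U `&` U1); split => //; first exact: openI.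
apply/Cinfty_Ck => k; apply: (@Ck_comp_mx _ _ _ _ _ _ _ U').
- exact: openI.
- exact: oU'.
- by move=> y [_ /U1f].
- by apply: Ck_sub (Cf k) => y [].
- exact: Cg.
Qed.

Lemma smoothat_compR E N (f : E -> 'cV[R]_N) (g : 'cV[R]_N -> R^o) x :
  smoothat f x -> smoothat g (f x) -> smoothat (g \o f) x.
Proof.
move=> sf sg.
have -> : g \o f = (fun y => (\col_(i < 1) g (f y)) 0 0).
  by apply/funext => y; rewrite mxE.
apply: smoothat_entry.
apply: (@smoothat_comp _ _ _ _ f (fun z => \col_(i < 1) g z)) => //.
apply: smoothat_mx => i j.
by have -> : (fun y => (\col__ g y) i j) = g by apply/funext => y; rewrite mxE.
Qed.

Lemma smoothat_diffR N (g : 'cV[R]_N -> R^o) x : smoothat g x -> differentiable g x.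
Proof.
by move=> [U [oU Ux /Cinfty_Ck Cg]]; exact: Ck_differentiable (Cg 1%N) Ux.
Qed.

Lemma smoothat_diff N m (g : 'cV[R]_N -> 'cV[R]_m) x :
  smoothat g x -> differentiable g x.
Proof.
move=> sg; have -> : g = (\sum_(i < m) (fun z => (g z i 0 : R^o) *: ecol i)).
  by apply/funext => z; rewrite fct_sumE [LHS]cV_decomp.
apply: differentiable_sum => i; apply: differentiableZl.
by apply: smoothat_diffR; exact: smoothat_entry.
Qed.

Lemma derive_linear N W (g : 'cV[R]_N -> W) x : differentiable g x ->
  linear (fun v => 'D_v g x).
Proof.
by move=> dg a v w; rewrite /= !deriveE // linearP.
Qed.

(** Smoothness of the extension and its agreement with f become two separate
    conditions, each of which may shrink the neighbourhood on its own. *)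
Lemma smooth_extP E W (S : set E) (f : E -> W) x (F : E -> W) :
  smooth_ext S f x F <-> smoothat F x /\ \forall y \near x, S y -> F y = f y.
Proof.
split=> [[U [oU Ux CF Ff]]|[[U [oU Ux /Cinfty_Ck CF]] /near_open[U' [oU' U'x H]]]].
  by split; [exists U|apply: open_near oU Ux Ff].
exists (U `&` U'); split => //; first exact: openI.
  by apply/Cinfty_Ck => k; apply: Ck_sub (CF k) => y [].
by move=> y [_ /H].
Qed.

Lemma smooth_on_open E W (S : set E) (f : E -> W) x : open S -> S x ->
  smooth_on S f -> smoothat f x.
Proof.
move=> oS Sx /(_ x Sx)[F /smooth_extP[sF Ff]].
apply: smoothat_eq sF; near=> y; apply: (near Ff y) => //.
by near: y; exact: open_nbhs_nbhs.
Unshelve. all: by end_near. Qed.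

Lemma smoothat_smooth_ext E W (S : set E) (f : E -> W) x :
  smoothat f x -> smooth_ext S f x f.
Proof. by move=> sf; apply/smooth_extP; split => //; exact: nearW. Qed.

End SmoothAt.

(** * The inverse function theorem *)

Lemma lipschitz_continuous_at (R : realType) (E W : normedModType R) (A : set E)
    (K : E -> W) (y : E) (c : R) : open A -> A y ->
  (forall z, A z -> `|K y - K z| <= c * `|y - z|) -> {for y, continuous K}.
Proof.
move=> oA Ay KL; apply/cvgrPdist_le => /= e e0.
have c0 : 0 < `|c| + 1 by rewrite ltr_wpDl.
have /nbhs_ballP[d /= d0 dA] : nbhs y A by exact: open_nbhs_nbhs.
apply/nbhs_ballP; exists (Num.min d (e / (`|c| + 1))).
  by rewrite /= lt_min d0 divr_gt0.
move=> z; rewrite -ball_normE /= lt_min ltr_pdivlMr // => /andP[zd ze].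
apply: le_trans (KL z _) _; first by apply: dA; rewrite -ball_normE.
apply: le_trans (ltW ze); rewrite mulrC ler_wpM2l //.
by apply: le_trans (ler_norm _) _; rewrite lerDl.
Qed.

Section InverseFunction.
Context {R : realType} {N : nat}.
Notation V := 'cV[R]_N.

Definition jacobian_mx m (f : V -> 'cV[R]_m) (x : V) : 'M[R]_(m, N) :=
  \matrix_(i, j) ('D_(ecol j) f x) i 0.

Lemma jacobian_mxE m (f : V -> 'cV[R]_m) (x v : V) :
  differentiable f x -> 'D_v f x = jacobian_mx f x *m v.
Proof.
move=> df; rewrite diff_derive_sum //; apply/colP => i; rewrite summxE mxE.
by apply: eq_bigr => j _; rewrite !mxE mulrC.
Qed.

Lemma Ck_jacobian m k (U : set V) (f : V -> 'cV[R]_m) :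
  open U -> Ck k.+1 U f -> Ck k U (jacobian_mx f).
Proof.
move=> oU Cf; apply/Ck_mx => // i j.
have -> : (fun x => jacobian_mx f x i j : R^o) = (fun x => 'D_(ecol j) f x i 0).
  by apply/funext => x; rewrite mxE.
by have /(Ck_mx _ _ oU) := Ck_derive (ecol j) Cf; exact.
Qed.

Lemma inj_unitmx (J : 'M[R]_N) :
  (forall v : V, J *m v = 0 -> v = 0) -> J \in unitmx.
Proof.
move=> inj; rewrite -unitmx_tr -row_free_unit; apply: inj_row_free => v vJ.
apply: trmx_inj; rewrite trmx0; apply: inj.
by rewrite -[J]trmxK -trmx_mul vJ trmx0.
Qed.

Lemma differentiable_le (W : normedModType R) (f : V -> W) (a : V) (e : R) :
  differentiable f a -> 0 < e ->
  \forall h \near (0 : V), `|f (h + a) - (f a + 'd f a h)| <= e * `|h|.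
Proof.
move=> /diff_locallyP[_ H] e0.
have := H; move=> /eqaddoP /(_ e e0); exact.
Qed.

(** The space of columns is complete and normed; the structure that joins both,
    on which the fixed point theorem is stated, is assembled here. *)
Lemma contraction_fixpoint (x0 : V) (r : R) (phi : V -> V) : 0 <= r ->
  (forall x, `|x - x0| <= r -> `|phi x - x0| <= r) ->
  (forall x y, `|x - x0| <= r -> `|y - x0| <= r ->
     `|phi x - phi y| <= 2^-1 * `|x - y|) ->
  exists2 x, `|x - x0| <= r & x = phi x.
Proof.
move=> r0 phiS phiL.
pose X := HB.pack_for (completeNormedModType R) 'cV[R]_N.
pose B : set X := [set x | `|x - x0| <= r].
have phiB : set_fun B B phi by move=> x Bx; exact: phiS.
pose phiM := isFun.Build X X B B phi phiB.
pose phiF : {fun B >-> B} := HB.pack phi phiM.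
have cphi : is_contraction phiF.
  exists 2^-1%:nng; split; first by rewrite /= invf_lt1 // ltr1n.
  by move=> [x y] [Bx By]; exact: phiL.
have cB : closed B.
  have -> : B = (fun x => `|x - x0|) @^-1` [set t : R | t <= r] by [].
  apply: closed_comp; last exact: closed_le.
  move=> x _; apply: continuous_comp; last exact: norm_continuous.
  by apply: continuousB => //; exact: cst_continuous.
have [|p Bp pE] := @banach_fixed_point R X B phiF cphi cB.
  by exists x0; rewrite /B /= subrr normr0.
by exists p.
Qed.

(** The derivative at x0 is normalised to be the identity, so that x - f x is
    1/2-Lipschitz on a ball around x0 and x |-> x - f x + y is a contraction of
    it for y close to f x0: its fixed point is K y. Then K is 2-Lipschitz, its
    derivative at y is the inverse of the Jacobian matrix of f at K y, and this
    formula raises the differentiability class of K by one at each step. *)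
Theorem inverse_function (f : V -> V) (x0 : V) :
  smoothat f x0 -> (forall v, 'D_v f x0 = v) ->
  exists K : V -> V, [/\ K (f x0) = x0, smoothat K (f x0) &
    \forall y \near f x0, f (K y) = y].
Proof.
move=> [U [oU Ux0 /Cinfty_Ck Cf]] Df0.
have diffU x : U x -> differentiable f x.
  by move=> Ux; apply: smoothat_diff; exists U; split => //; exact/Cinfty_Ck.
have [r r0 Hr] : exists2 r : R, 0 < r & forall x, `|x - x0| <= r ->
    U x /\ forall v, `|'D_v f x - v| <= 2^-1 * `|v|.
  have e0 : 0 < (2%:R * N.+1%:R)^-1 :> R by rewrite invr_gt0 mulr_gt0.
  have : \forall x \near x0, U x /\
      forall j, `|'D_(ecol j) f x0 - 'D_(ecol j) f x| <= (2%:R * N.+1%:R)^-1.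
    near=> x; split; first by near: x; exact: open_nbhs_nbhs.
    near: x; apply: filter_forall => j.
    have := Ck_cont (Ck_derive (ecol j) (Cf 1%N)) Ux0.
    by move/cvgrPdist_le => /(_ _ e0).
  move=> /nbhs_ballP[r /= r0 Hr]; exists (r / 2); first by rewrite divr_gt0.
  move=> x xr; have [] := Hr x.
    rewrite -ball_normE /= distrC; apply: le_lt_trans xr _.
    by rewrite ltr_pdivrMr // ltr_pMr // ltr1n.
  move=> Ux Hj; split => // v.
  have -> : 'D_v f x - v = \sum_j v j 0 *: ('D_(ecol j) f x - ecol j).
    rewrite diff_derive_sum; last exact: diffU.
    rewrite {2}[v]cV_decomp -sumrB; apply: eq_bigr => j _.
    by rewrite scalerBr.
  apply: (@le_trans _ _ (\sum_(j < N) `|v| * (2%:R * N.+1%:R)^-1)).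
    apply: le_trans (ler_norm_sum _ _ _) _; apply: ler_sum => j _.
    rewrite normrZ; apply: ler_pM => //; first exact: ler_coord.
    by rewrite distrC -{1}(Df0 (ecol j)).
  rewrite sumr_const card_ord -[_ *+ N]mulr_natl mulrCA mulrC ler_wpM2r //.
  rewrite invfM mulrCA ger_pMr ?invr_gt0 // ler_pdivrMr // mul1r ler_nat //.
have seg a b c : `|a - x0| <= r -> `|b - x0| <= r -> 0 <= c <= 1 ->
    `|b + c *: (a - b) - x0| <= r.
  move=> ar br /andP[c0 c1].
  have -> : b + c *: (a - b) - x0 = c *: (a - x0) + (1 - c) *: (b - x0).
    apply/colP => i; rewrite !mxE; ring.
  apply: le_trans (ler_normD _ _) _; rewrite !normrZ (ger0_norm c0).
  rewrite (ger0_norm (_ : 0 <= 1 - c)) ?subr_ge0 //.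
  have := ler_wpM2l c0 ar; have := @ler_wpM2l _ (1 - c) _ _ _ br.
  rewrite subr_ge0 => /(_ c1); lra.
have lip a b : `|a - x0| <= r -> `|b - x0| <= r ->
    `|f a - f b - (a - b)| <= 2^-1 * `|a - b|.
  move=> ar br; apply: ler_cV_norm => [|i]; first by rewrite mulr_ge0.
  pose g (z : V) : R^o := (f z - z) i 0.
  pose k : V -> V := f - id.
  have dk z : `|z - x0| <= r -> is_derive z (a - b) k ('D_(a - b) f z - (a - b)).
    move=> /Hr[Uz _]; have d1 : derivable f z (a - b) := diff_derivable (diffU _ Uz).
    exact: (is_deriveB (derivableP d1) (is_derive_id z (a - b))).
  have [|c c01] := @mvt_segment R _ g b (a - b).
    move=> t t01; have [+ _] := dk _ (seg a b t ar br t01).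
    by move=> /derivable_mxP /(_ i 0).
  have [d1 d2] := dk _ (seg a b c ar br c01).
  have -> : 'D_(a - b) g (b + c *: (a - b)) = ('D_(a - b) k (b + c *: (a - b))) i 0.
    by rewrite (derive_mx d1) mxE.
  have bE : b + (a - b) = a by rewrite addrC subrK.
  rewrite d2 bE /g => E.
  have -> : (f a - f b - (a - b)) i 0 = (f a - a) i 0 - (f b - b) i 0.
    by rewrite !mxE; ring.
  rewrite E; apply: le_trans (ler_coord _ _) _.
  by have [_ +] := Hr _ (seg a b c ar br c01); exact.
have exK y : `|y - f x0| <= r / 2 -> exists2 x, `|x - x0| <= r & f x = y.
  move=> yr; have [||x xr xE] :=
      @contraction_fixpoint x0 r (fun x => x - f x + y) (ltW r0).
  - move=> x xr; have -> : x - f x + y - x0 = - (f x - f x0 - (x - x0)) + (y - f x0).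
      by apply/colP => i; rewrite !mxE; ring.
    apply: le_trans (ler_normD _ _) _; rewrite normrN.
    have := lip x x0 xr; rewrite subrr normr0 => /(_ (ltW r0)).
    lra.
  - move=> x z xr zr; have -> : x - f x + y - (z - f z + y) =
        - (f x - f z - (x - z)) by apply/colP => i; rewrite !mxE; ring.
    by rewrite normrN; exact: lip.
  exists x => //; apply/eqP; rewrite -subr_eq0; apply/eqP.
  by apply/colP => i; move/colP: xE => /(_ i); rewrite !mxE => xE; lra.
have exp a b : `|a - x0| <= r -> `|b - x0| <= r -> `|a - b| <= 2 * `|f a - f b|.
  move=> ar br; have := lip a b ar br.
  have : `|a - b| <= `|f a - f b| + `|f a - f b - (a - b)|.
    have {1}-> : a - b = (f a - f b) - (f a - f b - (a - b)).
      by apply/colP => i; rewrite !mxE; ring.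
    by apply: le_trans (ler_normB _ _) _.
  lra.
pose K y := xget x0 [set x | `|x - x0| <= r /\ f x = y].
pose W : set V := ball (f x0) (r / 2).
have HK y : W y -> `|K y - x0| <= r /\ f (K y) = y.
  rewrite /W -ball_normE /= distrC => /ltW /exK[x xr fx].
  by apply: (@xgetPex _ x0 [set x | `|x - x0| <= r /\ f x = y]); exists x.
have W0 : W (f x0) by apply: ballxx; rewrite divr_gt0.
have oW : open W by exact: ball_open.
have KL y z : W y -> W z -> `|K y - K z| <= 2 * `|y - z|.
  by move=> /HK[yr yE] /HK[zr zE]; have := exp _ _ yr zr; rewrite yE zE.
have Kx0 : K (f x0) = x0.
  have [xr fK] := HK _ W0; apply/eqP; rewrite -subr_eq0 -normr_le0.
  have x0r : `|x0 - x0| <= r by rewrite subrr normr0 ltW.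
  by have := exp _ _ xr x0r; rewrite fK (subrr (f x0)) normr0 mulr0.
have Junit x : `|x - x0| <= r -> jacobian_mx f x \in unitmx.
  move=> /Hr[Ux Hx]; apply: inj_unitmx => v Jv.
  have := Hx v; rewrite (jacobian_mxE _ (diffU _ Ux)) Jv sub0r normrN => Hv.
  by apply/eqP; rewrite -normr_le0; lra.
have cK y : W y -> {for y, continuous K}.
  by move=> Wy; apply: (lipschitz_continuous_at oW Wy) => z; exact: KL.
have dK y v : W y -> derivable K y v /\
    'D_v K y = invmx (jacobian_mx f (K y)) *m v.
  move=> Wy; set Ji := invmx _.
  suff : is_derive y v K (Ji *m v) by case.
  suff H : (fun h => h^-1 *: ((K \o shift y) (h *: v) - K y)) @ (0 : R)^' --> Ji *m v.
    by split; [apply/cvg_ex; exists (Ji *m v)|exact: cvg_lim H].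
  have [Kyr fKy] := HK y Wy; have [UKy _] := Hr _ Kyr.
  have [C C0 HC] : exists2 C : R, 0 < C & forall w : V, `|Ji *m w| <= C * `|w|.
    have [C C0 HC] := linear_lipschitz (@linear_cV_continuous _ _ _ (mulmx Ji)).
    by exists C.
  apply/cvgrPdist_le => /= e e0.
  (* |K (h v + y) - K y| <= 2 |h| |v|, and C bounds the inverse Jacobian;
     1 is added to |v| in case v = 0 *)
  pose e' := e / (C * (2 * (`|v| + 1))).
  have e'0 : 0 < e' by rewrite divr_gt0 // !mulr_gt0 // ltr_wpDl.
  have := differentiable_le (diffU _ UKy) e'0.
  move=> /nbhs_ballP[d /= d0 Hd].
  near=> h.
  have h0 : h != 0 by near: h; exact: nbhs_dnbhs_neq.
  have hW : W (h *: v + y).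
    near: h; apply: nbhs_dnbhs.
    have cl : {for (0 : R), continuous (fun h : R => h *: v + y)}.
      apply: continuousD; last exact: cst_continuous.
      exact: continuousZr_tmp.
    apply: (cl W); apply: open_nbhs_nbhs; split => //.
    by rewrite scale0r add0r.
  have hd : `|h| * (2 * (`|v| + 1)) < d.
    rewrite -ltr_pdivlMr; last by rewrite mulr_gt0 // ltr_wpDl.
    near: h; apply: dnbhs0_lt.
    by rewrite divr_gt0 // mulr_gt0 // ltr_wpDl.
  pose k := K (h *: v + y) - K y.
  have [hr fh] := HK _ hW.
  have kle : `|k| <= 2 * (`|h| * `|v|).
    by have := KL _ _ hW Wy; rewrite addrK normrZ.
  have kE : k + K y = K (h *: v + y) by rewrite subrK.
  have hv0 : 0 <= `|h| by [].
  have hkd : `|k| < d.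
    by apply: le_lt_trans kle _; apply: le_lt_trans hd; nra.
  have := Hd k; rewrite -ball_normE /= sub0r normrN => /(_ hkd).
  rewrite kE fh fKy -deriveE; last exact: diffU.
  rewrite jacobian_mxE; last exact: diffU.
  have -> : h *: v + y - (y + jacobian_mx f (K y) *m k) =
     h *: v - jacobian_mx f (K y) *m k by apply/colP => i; rewrite !mxE; ring.
  move=> Hk.
  have -> : Ji *m v - h^-1 *: k =
      h^-1 *: (Ji *m (h *: v - jacobian_mx f (K y) *m k)).
    rewrite mulmxBr mulmxA mulVmx ?Junit // mul1mx -scalemxAr [RHS]scalerBr scalerA.
    by rewrite mulVf // scale1r.
  rewrite normrZ normfV mulrC ler_pdivrMr ?normr_gt0 //.
  apply: le_trans (HC _) _; rewrite -ler_pdivlMl //.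
  apply: le_trans Hk _.
  apply: le_trans (ler_wpM2l (ltW e'0) kle) _.
  have v1 : 0 < `|v| + 1 by rewrite ltr_wpDl.
  have -> : e' * (2 * (`|h| * `|v|)) = C^-1 * (e * `|h|) * (`|v| / (`|v| + 1)).
    by rewrite /e'; field; rewrite !gt_eqF.
  rewrite ler_piMr //; last by rewrite ler_pdivrMr // mul1r lerDl.
  by rewrite mulr_ge0 // ?invr_ge0 ?mulr_ge0 // ltW.
have CK k : Ck k W K.
  elim: k => [|k IH]; first by split.
  apply: (Ck_of_derive oW cK dK) => v.
  apply: Ck_mulmx => //; last exact: Ck_cst.
  apply: Ck_invmx => //; first by move=> y /HK[yr _]; exact: Junit.
  apply: (Ck_comp_mx oW oU _ IH); first by move=> y /HK[/Hr[]].
  exact: Ck_jacobian.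
exists K; split => //.
- by exists W; split => //; exact/Cinfty_Ck.
- by apply: (open_near oW W0) => y /HK[].
Unshelve. all: by end_near. Qed.

End InverseFunction.

(** * The exponential of a matrix whose square is scalar *)

Section ExpSeries.
Context {R : realType}.

(** A growth condition that makes the power series converge everywhere and is
    stable under termwise differentiation. *)
Definition exp_bounded (f : nat -> R) :=
  exists M mu : R, [/\ 0 <= M, 0 <= mu & forall i, `|f i| <= M * (mu ^+ i / i`!%:R)].

Lemma exp_bounded_cvg f x : exp_bounded f -> cvgn (pseries f x).
Proof.
move=> [M [mu [M0 mu0 fM]]]; apply: normed_cvg.
apply: (@series_le_cvg _ _ (M \*: exp_coeff (mu * `|x|))) => [n|n|n|].
- by rewrite /=.
- by rewrite /= mulr_ge0 // exp_coeff_ge0 // mulr_ge0.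
- rewrite /= normrM normrX exp_coeffE.
  apply: le_trans (ler_wpM2r _ (fM n)) _; first exact: exprn_ge0.
  rewrite /= exprMn le_eqVlt; apply/orP; left; apply/eqP.
  by rewrite /GRing.scale /=; field; rewrite pnatr_eq0 -lt0n fact_gt0.
- by apply: is_cvg_seriesZ; exact: is_cvg_series_exp_coeff.
Qed.

Lemma exp_bounded_diffs f : exp_bounded f -> exp_bounded (pseries_diffs f).
Proof.
move=> [M [mu [M0 mu0 fM]]]; exists (M * mu), mu; split => //.
  exact: mulr_ge0.
move=> i; rewrite /pseries_diffs normrM ger0_norm //.
apply: le_trans (ler_wpM2l _ (fM i.+1)) _ => //.
rewrite le_eqVlt; apply/orP; left; apply/eqP.
rewrite factS natrM exprS; field.
by rewrite pnatr_eq0 -lt0n fact_gt0 /= addrC natr1 pnatr_eq0.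
Qed.

Lemma exp_bounded_derive f x : exp_bounded f ->
  is_derive x (1 : R) (fun t => limn (pseries f t)) (limn (pseries (pseries_diffs f) x)).
Proof.
move=> bf; have bf1 := exp_bounded_diffs bf; have bf2 := exp_bounded_diffs bf1.
apply: (@pseries_snd_diffs _ f (`|x| + 1)); try exact: exp_bounded_cvg.
by rewrite [ltRHS]ger0_norm ?ltrDl // addr_ge0.
Qed.

Lemma pseries_0 (f : nat -> R) : limn (pseries f 0) = f 0%N.
Proof.
apply: lim_near_cst => //.
near=> n; rewrite /pseries /series /=.
have n0 : (0 < n)%N by near: n; exact: nbhs_infty_gt.
rewrite -(prednK n0) big_nat_recl // expr0 mulr1 big1 ?addr0 // => i _.
by rewrite expr0n mulr0.
Unshelve. all: by end_near. Qed.

End ExpSeries.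

Section ExpQuadratic.
Context {R : realType} {k : nat}.
Variables (A : 'M[R]_(k + k)) (lambda : R).
Hypothesis A2 : A *m A = lambda%:M.

(** Since A^(2j) = lambda^j and A^(2j+1) = lambda^j A, the exponential of tA is
    c(t) + s(t) A; [cos_coef] and [sin_coef] are the Taylor coefficients of c
    and s. For lambda = -1 these are the cosine and the sine, for lambda = 1
    their hyperbolic analogues, and for lambda = 0 the functions 1 and t. *)
Definition cos_coef (i : nat) : R := if odd i then 0 else lambda ^+ i./2 / i`!%:R.
Definition sin_coef (i : nat) : R := if odd i then lambda ^+ i./2 / i`!%:R else 0.

Lemma lambda_half i : `|lambda ^+ i./2| <= (`|lambda| + 1) ^+ i.
Proof.
rewrite normrX; apply: (@le_trans _ _ ((`|lambda| + 1) ^+ i./2)).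
  by apply: lerXn2r; rewrite ?nnegrE ?addr_ge0 // lerDl.
by apply: ler_weXn2l; [rewrite lerDr|rewrite -{2}[i]odd_double_half -addnn addnA leq_addl].
Qed.

Lemma cos_bounded : exp_bounded cos_coef.
Proof.
exists 1, (`|lambda| + 1); split => //.
move=> i; rewrite mul1r /cos_coef; case: odd.
  by rewrite normr0 divr_ge0 // exprn_ge0 // addr_ge0.
by rewrite normrM [X in _ * X]ger0_norm // ler_wpM2r // lambda_half.
Qed.

Lemma sin_bounded : exp_bounded sin_coef.
Proof.
exists 1, (`|lambda| + 1); split => //.
move=> i; rewrite mul1r /sin_coef; case: odd; last first.
  by rewrite normr0 divr_ge0 // exprn_ge0 // addr_ge0.
by rewrite normrM [X in _ * X]ger0_norm // ler_wpM2r // lambda_half.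
Qed.

Lemma fact_natr i : (i.+1%:R * (i.+1`!%:R)^-1 = (i`!%:R)^-1 :> R).
Proof.
by rewrite factS natrM invfM mulrA mulfV ?mul1r // pnatr_eq0.
Qed.

Lemma cos_diffs : pseries_diffs cos_coef = (fun i => lambda * sin_coef i).
Proof.
apply/funext => i; rewrite /pseries_diffs /cos_coef /sin_coef /=.
case oi : (odd i) => /=; last by rewrite !mulr0.
by rewrite mulrCA fact_natr uphalf_half oi exprS mulrA.
Qed.

Lemma sin_diffs : pseries_diffs sin_coef = cos_coef.
Proof.
apply/funext => i; rewrite /pseries_diffs /cos_coef /sin_coef /=.
case oi : (odd i) => /=; first by rewrite !mulr0.
by rewrite mulrCA fact_natr uphalf_half oi.
Qed.

Definition cosA (t : R) : R := limn (pseries cos_coef t).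
Definition sinA (t : R) : R := limn (pseries sin_coef t).

Lemma cosA0 : cosA 0 = 1.
Proof. by rewrite /cosA pseries_0 /cos_coef /= expr0 divr1. Qed.

Lemma sinA0 : sinA 0 = 0.
Proof. by rewrite /sinA pseries_0. Qed.

Lemma is_derive_sinA t : is_derive t (1 : R) sinA (cosA t).
Proof. by rewrite /cosA -sin_diffs; apply: exp_bounded_derive; exact: sin_bounded. Qed.

Lemma is_derive_cosA t : is_derive t (1 : R) cosA (lambda * sinA t).
Proof.
have -> : lambda * sinA t = limn (pseries (pseries_diffs cos_coef) t).
  rewrite cos_diffs /sinA.
  have -> : pseries (fun i => lambda * sin_coef i) t =
      lambda \*: pseries sin_coef t.
    apply/funext => n; rewrite /pseries /series /= scaler_sumr.
    by apply: eq_bigr => i _; rewrite -mulrA.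
  by rewrite limZl_tmp //; apply: exp_bounded_cvg; exact: sin_bounded.
by apply: exp_bounded_derive; exact: cos_bounded.
Qed.

(** The left side has derivative zero, as c' = lambda s and s' = c. This is what
    makes the flow preserve the hypersurface. *)
Lemma cosA_sinA t : cosA t ^+ 2 - lambda * sinA t ^+ 2 = 1.
Proof.
pose f (t : R) := cosA t ^+ 2 - lambda * sinA t ^+ 2.
have df (x : R) : is_derive x (1 : R) f 0.
  have dc := is_derive_cosA x; have ds := is_derive_sinA x.
  have -> : f = cosA ^+ 2 - lambda \*: (sinA ^+ 2).
    by apply/funext => y.
  apply: is_derive_eq.
  rewrite /= !expr1 /GRing.scale /=; ring.
have -> : 1 = f 0 by rewrite /f cosA0 sinA0; ring.
exact: (@is_derive_0_is_cst R f).
Qed.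

Lemma expr_quadratic i :
  A ^+ i = (if odd i then 0 else lambda ^+ i./2)%:M +
           (if odd i then lambda ^+ i./2 else 0) *: A.
Proof.
elim: i => [|i IH]; first by rewrite expr0 scale0r addr0.
rewrite exprS IH /= uphalf_half; case: odd => /=.
  rewrite scale0r addr0 -[_ * _]/(A *m _) mulmxDr -scalemxAr A2.
  rewrite raddf0 mulmx0 add0r add1n exprS scale_scalar_mx.
  by rewrite mulrC.
rewrite raddf0 scale0r addr0 add0r add0n -[_ * _]/(A *m _).
by rewrite scalar_mxC mul_scalar_mx.
Qed.

Lemma expmZn t i : (t *: A) ^+ i = t ^+ i *: A ^+ i.
Proof.
elim: i => [|i IH]; first by rewrite !expr0 scale1r.
rewrite !exprS IH -[LHS]/((t *: A) *m (t ^+ i *: A ^+ i)).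
by rewrite -scalemxAl -scalemxAr scalerA.
Qed.

Lemma expmx_quadratic t : expmx (t *: A) = (cosA t)%:M + sinA t *: A.
Proof.
have E : series (fun i : nat => (i`!%:R)^-1 *: (t *: A) ^+ i) =
  (fun n => pseries cos_coef t n *: 1%:M + pseries sin_coef t n *: A).
  apply/funext => n; rewrite /pseries /series /= !scaler_suml -big_split.
  apply: eq_bigr => i _ /=.
  rewrite expmZn expr_quadratic scalerA /cos_coef /sin_coef scalerDr -scalemx1.
  rewrite !scalerA.
  by case: odd; rewrite ?mulr0 ?mul0r //; congr (_ *: _ + _ *: _); ring.
rewrite /expmx E -[(cosA t)%:M]scalemx1; apply: cvg_lim => //.
have c1 : pseries cos_coef t @ \oo --> cosA t.
  by apply: exp_bounded_cvg; exact: cos_bounded.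
have s1 : pseries sin_coef t @ \oo --> sinA t.
  by apply: exp_bounded_cvg; exact: sin_bounded.
have c2 := cvgZr_tmp (a := 1%:M : 'M[R]_(k + k)) c1.
have s2 := cvgZr_tmp (a := A) s1.
exact: (cvgD (c2 _) (s2 _)).
Qed.

End ExpQuadratic.

(** * Symplectic algebra of the hypersurface and of its symmetries *)

Section Symplectic.
Context {R : realType} {k : nat}.
Notation V := 'cV[R]_(k + k).
Implicit Types (u v w x : V) (a : R).

Definition Jmx : 'M[R]_(k + k) := block_mx 0 1%:M (- 1%:M) 0.

Lemma Jmx_tr : Jmx^T = - Jmx.
Proof. by rewrite tr_block_mx opp_block_mx !linearN /= !trmx1 !trmx0 oppr0 opprK. Qed.

Lemma Jmx_sqr : Jmx *m Jmx = - 1%:M.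
Proof.
rewrite mulmx_block !mul0mx !mulmx0 !mulmx1 !mul1mx !addr0 !add0r.
by rewrite [1%:M in RHS]scalar_mx_block opp_block_mx oppr0.
Qed.

Lemma OmegaDl u v w : Omega (u + v) w = Omega u w + Omega v w.
Proof. by rewrite /Omega linearD /= !mulmxDl mxE. Qed.
Lemma OmegaDr u v w : Omega u (v + w) = Omega u v + Omega u w.
Proof. by rewrite /Omega !mulmxDr mxE. Qed.
Lemma OmegaZl a u v : Omega (a *: u) v = a * Omega u v.
Proof. by rewrite /Omega linearZ /= -!scalemxAl mxE. Qed.
Lemma OmegaZr a u v : Omega u (a *: v) = a * Omega u v.
Proof. by rewrite /Omega -!scalemxAr mxE. Qed.
Lemma OmegaNl u v : Omega (- u) v = - Omega u v.
Proof. by rewrite -scaleN1r OmegaZl mulN1r. Qed.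
Lemma OmegaNr u v : Omega u (- v) = - Omega u v.
Proof. by rewrite -scaleN1r OmegaZr mulN1r. Qed.

Lemma OmegaC u v : Omega u v = - Omega v u.
Proof.
rewrite /Omega -/Jmx -[u^T *m Jmx *m v]trmxK [LHS]mxE !trmx_mul trmxK Jmx_tr.
by rewrite mulNmx mulmxN mulmxA mxE.
Qed.

Lemma Omegaxx u : Omega u u = 0.
Proof. by have := OmegaC u u; lra. Qed.

Definition OmegaE := (OmegaDl, OmegaDr, OmegaZl, OmegaZr, OmegaNl, OmegaNr).

(** The columns - J e_i form the basis dual to the e_i with respect to Omega. *)
Lemma Omega_dual v : \sum_i Omega v (- Jmx *m ecol i) *: ecol i = v.
Proof.
rewrite [RHS]cV_decomp; apply: eq_bigr => i _; congr (_ *: _).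
rewrite /Omega -/Jmx mulNmx mulmxN mulmxA -[v^T *m Jmx *m Jmx]mulmxA Jmx_sqr.
rewrite mulmxN mulNmx opprK mulmx1 mxE (bigD1 i) //= big1 => [|j ji].
  by rewrite !mxE !eqxx mulr1 addr0.
by rewrite !mxE (negPf ji) mulr0.
Qed.

Lemma smoothat_trmx (E : normedModType R) m n (f : E -> 'M[R]_(m, n)) e :
  smoothat f e -> smoothat (fun y => (f y)^T) e.
Proof.
move=> sf; apply: smoothat_mx => i j.
have -> : (fun y => (f y)^T i j : R^o) = (fun y => f y j i).
  by apply/funext => y; rewrite mxE.
exact: smoothat_entry.
Qed.

Lemma smoothat_Omega (E : normedModType R) (f g : E -> V) e :
  smoothat f e -> smoothat g e -> smoothat (fun y => Omega (f y) (g y) : R^o) e.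
Proof.
move=> sf sg; apply: smoothat_entry; apply: smoothat_mulmx => //.
apply: smoothat_mulmx; first exact: smoothat_trmx.
exact: smoothat_cst.
Qed.

Lemma smoothatZ (E : normedModType R) m (f : E -> R^o) (g : E -> 'cV[R]_m) e :
  smoothat f e -> smoothat g e -> smoothat (fun y => f y *: g y) e.
Proof.
move=> sf sg; apply: smoothat_mx => i j.
have -> : (fun y => (f y *: g y) i j : R^o) = (fun y => f y * g y i j).
  by apply/funext => y; rewrite mxE.
exact: (smoothatM sf (smoothat_entry i j sg)).
Qed.

Lemma smoothat_mulmxl (E : normedModType R) m n (B : 'M[R]_(m, n)) (f : E -> 'cV[R]_n) e :
  smoothat f e -> smoothat (fun y => B *m f y) e.
Proof. by move=> sf; apply: smoothat_mulmx => //; exact: smoothat_cst. Qed.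

Lemma smoothat_id n (x : 'cV[R]_n) : smoothat id x.
Proof.
apply: (@smoothat_linear _ _ _ idfun) => y; exact: cvg_id.
Qed.

Lemma smoothatN (E : normedModType R) m (f : E -> 'cV[R]_m) e :
  smoothat f e -> smoothat (fun y => - f y) e.
Proof.
move=> sf; have -> : (fun y => - f y) = (fun y => (- 1%:M) *m f y).
  by apply/funext => y; rewrite mulNmx mul1mx.
exact: smoothat_mulmxl.
Qed.

(** Enough for the functions x |-> Omega x (A x) and x |-> Omega x y, whose
    expansion along a line stops at order two. *)
Lemma is_derive_quadratic (E : normedModType R) (f : E -> R^o) (x v : E) (a b : R) :
  (forall h : R, f (h *: v + x) = f x + h * a + h ^+ 2 * b) -> is_derive x v f a.
Proof.
move=> fE.
suff H : (fun h => h^-1 *: ((f \o shift x) (h *: v) - f x)) @ (0 : R)^' --> a.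
  by split; [apply/cvg_ex; exists a|exact: cvg_lim H].
have H : (fun h : R => a + h * b) @ (0 : R)^' --> a.
  have cl : {for (0 : R), continuous (fun h : R => a + h * b)}.
    apply: continuousD; first exact: cst_continuous.
    by apply: continuousM; [exact: cvg_id|exact: cst_continuous].
  by move/continuous_withinNx : cl; rewrite mul0r addr0.
apply: cvg_trans H; apply: near_eq_cvg; near=> h.
have h0 : h != 0 by near: h; exact: nbhs_dnbhs_neq.
by rewrite /= fE /GRing.scale /=; field.
Unshelve. all: by end_near. Qed.

Variables (A : 'M[R]_(k + k)) (lambda : R).
Hypotheses (hA : in_sp A) (hA2 : A *m A = lambda%:M).

Lemma OmegaA u v : Omega (A *m u) v = - Omega u (A *m v).
Proof. by have := hA u v; lra. Qed.

Lemma AA u : A *m (A *m u) = lambda *: u.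
Proof. by rewrite mulmxA hA2 mul_scalar_mx. Qed.

Lemma OmegaAC u v : Omega u (A *m v) = Omega v (A *m u).
Proof. by rewrite OmegaC OmegaA opprK. Qed.

Lemma is_derive_Sigma x v :
  is_derive x v (fun y : V => Omega y (A *m y) : R^o) (2 * Omega v (A *m x)).
Proof.
apply: (@is_derive_quadratic _ _ _ _ _ (Omega v (A *m v))) => h.
by rewrite mulmxDr -scalemxAr !OmegaE (OmegaAC x v); ring.
Qed.

Lemma tangent_SigmaP x v : tangent_Sigma A x v <-> Omega v (A *m x) = 0.
Proof.
rewrite /tangent_Sigma /= (@derive_val _ _ _ _ _ _ _ (is_derive_Sigma x v)).
split=> [/eqP|->]; last by rewrite mulr0.
by rewrite mulf_eq0 pnatr_eq0 /= => /eqP.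
Qed.

(** The linear symmetry S_x at a point x of the hypersurface: it fixes the plane
    spanned by x and A x and is minus the identity on the horizontal space,
    the orthogonal of that plane. See [sym_mxE] for the formula. *)
Definition sym_mx x : 'M[R]_(k + k) :=
  - 1%:M + (2 *: (x *m (Jmx *m (A *m x))^T) - 2 *: (A *m x *m (Jmx *m x)^T)).

Lemma row_Omega u v w : u *m (Jmx *m v)^T *m w = - Omega v w *: u.
Proof.
rewrite -mulmxA [X in u *m X]mx11_scalar mul_mx_scalar; congr (_ *: _).
by rewrite trmx_mul Jmx_tr mulmxN mulNmx mxE.
Qed.

Lemma sym_mxE x v : sym_mx x *m v =
  - v + ((2 * Omega v (A *m x)) *: x - (2 * Omega v x) *: (A *m x)).
Proof.
rewrite /sym_mx mulmxDl mulmxBl mulNmx mul1mx -!scalemxAl !row_Omega !scalerA.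
rewrite (OmegaC (A *m x) v) (OmegaC x v) !opprK.
by [].
Qed.

Lemma sym_mx_horizontal x v : horizontal A x v -> sym_mx x *m v = - v.
Proof. by move=> [h1 h2]; rewrite sym_mxE h1 h2 mulr0 !scale0r subrr addr0. Qed.

Lemma sym_mx_A x v : sym_mx x *m (A *m v) = A *m (sym_mx x *m v).
Proof.
rewrite !sym_mxE !OmegaA AA mulmxDr mulmxBr mulmxN -!scalemxAr AA !OmegaE.
by apply/colP => i; rewrite !mxE; ring.
Qed.

Section AtSigma.
Variable x : V.
Hypothesis hx : Sigma A x.

Lemma Sigma1 : Omega (A *m x) x = -1.
Proof. by rewrite OmegaC hx. Qed.

Lemma sym_mx_Omega u v : Omega (sym_mx x *m u) (sym_mx x *m v) = Omega u v.
Proof.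
rewrite !sym_mxE !OmegaE Sigma1 !Omegaxx (hx : Omega x (A *m x) = 1).
rewrite (OmegaC x v) (OmegaC (A *m x) v); ring.
Qed.

Lemma sym_mx_x : sym_mx x *m x = x.
Proof.
rewrite sym_mxE Omegaxx (hx : Omega x (A *m x) = 1).
by apply/colP => i; rewrite !mxE; ring.
Qed.

Lemma sym_mxK v : sym_mx x *m (sym_mx x *m v) = v.
Proof.
rewrite [LHS]sym_mxE !sym_mxE !OmegaE Sigma1 !Omegaxx (hx : Omega x (A *m x) = 1).
by apply/colP => i; rewrite !mxE; ring.
Qed.

Lemma sym_mx_Sigma y : Sigma A y -> Sigma A (sym_mx x *m y).
Proof. by move=> hy; rewrite /Sigma /= -sym_mx_A sym_mx_Omega. Qed.

Lemma sym_mx_hor_map y v : horizontal A y v -> horizontal A (sym_mx x *m y) (sym_mx x *m v).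
Proof. by move=> [h1 h2]; split; rewrite -?sym_mx_A sym_mx_Omega. Qed.

(** A linear map B that preserves Omega and commutes with A satisfies
    S_(B y) B = B S_y, because S_y is defined from y, A and Omega; here B is
    S_x, which is its own inverse. *)
Lemma sym_mx_conj y v : sym_mx (sym_mx x *m y) *m v = sym_mx x *m (sym_mx y *m (sym_mx x *m v)).
Proof.
rewrite -{1}(sym_mxK v); set w := sym_mx x *m v.
rewrite [LHS]sym_mxE -!sym_mx_A !sym_mx_Omega [sym_mx y *m w]sym_mxE.
by rewrite !mulmxDr !mulmxN -!scalemxAr.
Qed.

(** The projection onto the horizontal space along the plane of x and A x. *)
Definition hor_proj v : V := v - Omega v (A *m x) *: x + Omega v x *: (A *m x).

Lemma hor_proj_horizontal v : horizontal A x (hor_proj v).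
Proof.
split; rewrite /hor_proj !OmegaE ?Sigma1 ?Omegaxx ?(hx : Omega x (A *m x) = 1); ring.
Qed.

End AtSigma.

Lemma hor_proj_id x v : horizontal A x v -> hor_proj x v = v.
Proof. by move=> [h1 h2]; rewrite /hor_proj h1 h2 !scale0r subr0 addr0. Qed.

(** The flow moves x inside the plane of x and A x and preserves Omega: hence
    S_x depends only on the orbit of x, and descends to the quotient. *)
Lemma sym_mx_flow x (c s : R) v : c ^+ 2 - lambda * s ^+ 2 = 1 ->
  sym_mx (c *: x + s *: (A *m x)) *m v = sym_mx x *m v.
Proof.
move=> cs; rewrite !sym_mxE mulmxDr -!scalemxAr AA !OmegaE.
apply/colP => i; rewrite !mxE.
set a := Omega v x; set b := Omega v (A *m x).
set xi := x i 0; set yi := \sum_j _.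
have -> : - v i 0 + (2 * b * xi - 2 * a * yi) =
  - v i 0 + (2 * b * xi - 2 * a * yi) * (c ^+ 2 - lambda * s ^+ 2) by rewrite cs; ring.
ring.
Qed.

Lemma flow_Omega x y (c s : R) : c ^+ 2 - lambda * s ^+ 2 = 1 ->
  Omega (c *: x + s *: (A *m x)) (c *: y + s *: (A *m y)) = Omega x y.
Proof.
move=> cs; rewrite !OmegaE !OmegaA AA !OmegaE.
rewrite -[RHS]mul1r -cs.
ring.
Qed.

(** The linear field x |-> (F A + A F) x, where F v = Omega w v *: u has rank
    at most one. The matrix F A + A F commutes with A because A^2 is scalar, so these
    fields are invariant under the flow. *)
Definition comm_field (w u x : V) : V := Omega w (A *m x) *: u + Omega w x *: (A *m u).

Lemma comm_field_flow w u x (c s : R) :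
  comm_field w u (c *: x + s *: (A *m x)) =
  c *: comm_field w u x + s *: (A *m comm_field w u x).
Proof.
rewrite /comm_field !mulmxDr -!scalemxAr !AA !OmegaE.
by apply/colP => i; rewrite !mxE; ring.
Qed.

(** Any vector field, multiplied by a function that is 1 at w when w lies on the
    hypersurface, is a combination of the fields [comm_field w (ecol i)], which are
    defined everywhere. This formula does the work of local frames and bump
    functions in the proof that the difference of two connections is a tensor. *)
Lemma comm_field_complete w x v :
  \sum_i Omega v (comm_field w (- Jmx *m ecol i) x) *: comm_field w (ecol i) x =
  (Omega w (A *m x) ^+ 2 - lambda * Omega w x ^+ 2) *: v.
Proof.
set a := Omega w (A *m x); set b := Omega w x.
have -> : \sum_i Omega v (comm_field w (- Jmx *m ecol i) x) *: comm_field w (ecol i) x =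
  a *: (\sum_i Omega (a *: v - b *: (A *m v)) (- Jmx *m ecol i) *: ecol i)
  + b *: (A *m (\sum_i Omega (a *: v - b *: (A *m v)) (- Jmx *m ecol i) *: ecol i)).
  rewrite mulmx_sumr !scaler_sumr -big_split; apply: eq_bigr => i _ /=.
  rewrite /comm_field -/a -/b -scalemxAr !scalerA !OmegaE OmegaA scalerDr !scalerA.
  by congr (_ *: _ + _ *: _); ring.
rewrite Omega_dual mulmxBr -!scalemxAr AA.
by apply/colP => i; rewrite !mxE; ring.
Qed.

End Symplectic.

(** * Derivatives of maps given on the hypersurface *)

Section Curves.
Context {R : realType} {N : nat}.
Notation V := 'cV[R]_N.

Lemma is_derive_lincomb (a b : R -> R) (a' b' : R) (x w : V) (t : R) :
  is_derive t (1 : R) a a' -> is_derive t (1 : R) b b' ->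
  is_derive t (1 : R) (fun s => a s *: x + b s *: w) (a' *: x + b' *: w).
Proof.
move=> da db.
have de i j : is_derive t (1 : R) (fun s => (a s *: x + b s *: w) i j)
    ((a' *: x + b' *: w) i j).
  have -> : (fun s => (a s *: x + b s *: w) i j) = x i j \*: a + w i j \*: b.
    by apply/funext => s; rewrite !mxE mulrC [X in _ + X]mulrC.
  apply: is_derive_eq.
  by rewrite !mxE /GRing.scale /=; ring.
have dd : derivable (fun s => a s *: x + b s *: w) t 1.
  by apply/derivable_mxP => i j; exact: ex_derive.
split => //; rewrite derive_mx //; apply/matrixP => i j.
by rewrite mxE derive_val.
Qed.

(** Both derivatives are the velocity at 0 of the image of the curve g. *)
Lemma curve_derive_unique (W : normedModType R) (S : set V) (F1 F2 : V -> W)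
    (x v : V) (g : R -> V) :
  g 0 = x -> is_derive (0 : R) 1 g v -> (\forall t \near (0 : R), S (g t)) ->
  differentiable F1 x -> differentiable F2 x ->
  (\forall y \near x, S y -> F1 y = F2 y) -> 'D_v F1 x = 'D_v F2 x.
Proof.
move=> g0 dg Sg dF1 dF2 F12.
have dg1 : derivable g 0 1 by case: dg.
have cg : {for (0 : R), continuous g}.
  by apply: differentiable_continuous; apply/derivable1_diffP.
have H F : differentiable F x -> 'D_v F x = 'D_1 (F \o g) (0 : R).
  move=> dF; have [|_ ->] := @derive_comp_diff R _ _ _ g F 0 1 dg1; rewrite g0 //.
  by rewrite derive_val.
rewrite !H //; apply: near_eq_derive.
have F12g : \forall t \near (0 : R), S (g t) -> F1 (g t) = F2 (g t).
  by apply: (cg (fun y => S y -> F1 y = F2 y)); rewrite g0.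
by near do (apply: (near F12g) => //; exact: (near Sg)).
Unshelve. all: by end_near. Qed.

End Curves.

Section SigmaTangent.
Context {R : realType} {k : nat}.
Notation V := 'cV[R]_(k + k).
Variables (A : 'M[R]_(k + k)) (lambda : R).
Hypotheses (hA : in_sp A) (hA2 : A *m A = lambda%:M).

(** For v tangent, q y = Omega y (A y) satisfies q (x + t v) = 1 + c t^2; the line
    x + t v, divided by the square root of this number, stays on the
    hypersurface and still has velocity v at t = 0. *)
Lemma Sigma_derive_unique (W : normedModType R) (F1 F2 : V -> W) (x v : V) :
  Sigma A x -> tangent_Sigma A x v ->
  differentiable F1 x -> differentiable F2 x ->
  (\forall y \near x, Sigma A y -> F1 y = F2 y) -> 'D_v F1 x = 'D_v F2 x.
Proof.
move=> hx /(tangent_SigmaP hA) hv.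
pose c := Omega v (A *m v).
pose f (t : R) : R := 1 + t ^+ 2 * c.
pose rho (t : R) : R := (Num.sqrt (f t))^-1.
have f0 : f 0 = 1 by rewrite /f expr0n mul0r addr0.
have df : is_derive (0 : R) (1 : R) f 0.
  apply: (@is_derive_quadratic _ _ (f : R^o -> R^o) (0 : R^o) (1 : R^o) 0 c) => h.
  by rewrite f0 /f /= [h *: _]mulr1 addr0 mulr0 addr0.
have drho : is_derive (0 : R) (1 : R) rho 0.
  have dsq : is_derive (0 : R) (1 : R) (Num.sqrt \o f) 0.
    have := @is_derive1_comp R Num.sqrt f 0 (2 * Num.sqrt (f 0))^-1 0.
    rewrite f0 mulr0; apply => //; apply: is_derive1_sqrt; exact: ltr01.
  have := @is_deriveV R (Num.sqrt \o f) 0 0 1.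
  rewrite /= f0 sqrtr1 scaler0; apply => //; exact: oner_neq0.
have dtrho : is_derive (0 : R) (1 : R) (fun t => t * rho t) 1.
  have -> : (fun t => t * rho t) = id * rho by [].
  apply: is_derive_eq.
  by rewrite /rho f0 sqrtr1 invr1 scale0r add0r /GRing.scale /= mulr1.
apply: (@curve_derive_unique _ _ _ (Sigma A) _ _ _ _
  (fun t => rho t *: x + (t * rho t) *: v)).
- by rewrite /rho f0 sqrtr1 invr1 scale1r mul0r scale0r addr0.
- by have := is_derive_lincomb x v drho dtrho; rewrite scale0r scale1r add0r.
- have fpos : \forall t \near (0 : R), 0 < f t.
    have cf : {for (0 : R), continuous f}.
      apply: differentiable_continuous; apply/derivable1_diffP; by case: df.
    by apply: (cf [set z : R | 0 < z]); apply: open_nbhs_nbhs; split;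
      [exact: open_gt|rewrite /= f0].
  near=> t; rewrite /Sigma /= mulmxDr -!scalemxAr !OmegaE.
  have ft : 0 < f t by near: t.
  rewrite (OmegaAC hA x v) hv (hx : Omega x (A *m x) = 1) -/c.
  transitivity (f t * rho t ^+ 2); first by rewrite /f; ring.
  by rewrite /rho exprVn sqr_sqrtr ?ltW // mulfV // gt_eqF.
Unshelve. all: by end_near. Qed.

(** Makes [derive_on] computable: any smooth extension may be used. *)
Lemma derive_onE m (f F : V -> 'cV[R]_m) (x v : V) :
  Sigma A x -> tangent_Sigma A x v -> smooth_ext (Sigma A) f x F ->
  derive_on (Sigma A) f x v = 'D_v F x.
Proof.
move=> hx hv hF; rewrite /derive_on.
have : smooth_ext (Sigma A) f x (xget f [set F | smooth_ext (Sigma A) f x F]).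
  by apply: (@xgetPex _ f [set F | smooth_ext (Sigma A) f x F]); exists F.
move: hF => /smooth_extP[sF Ff] /smooth_extP[sF' F'f].
apply: Sigma_derive_unique => //; try exact: smoothat_diff.
near=> y => Sy; rewrite (near F'f y) // (near Ff y) //.
Unshelve. all: by end_near. Qed.

End SigmaTangent.

(** * Changes of charts *)

Section ManifoldLemmas.
Context {R : realType} {m : nat} (M : smooth_manifold R m).

Lemma chart_in (p q : M) : chart_dom p q -> chart_codom p (chart p q).
Proof. by move=> pq; exists q. Qed.

Lemma param_in (p : M) u : chart_codom p u ->
  chart_dom p (param p u) /\ chart p (param p u) = u.
Proof. by move=> [q pq <-]; rewrite chartK. Qed.

Lemma near_chart_dom (p q : M) (O : set M) : chart_dom p q -> open O -> O q ->
  \forall u \near chart p q, chart_codom p u /\ O (param p u).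
Proof.
move=> pq oO Oq.
have c1 : \forall u \near chart p q, chart_codom p u.
  apply: open_nbhs_nbhs; split; [exact: chart_codom_open|exact: chart_in].
have cp := param_continuous (chart_in pq).
have c2 : \forall u \near chart p q, O (param p u).
  by apply: (cp O); rewrite chartK //; exact: open_nbhs_nbhs.
exact: filterI c1 c2.
Qed.

Lemma transition_smoothat (p q r : M) : chart_dom p r -> chart_dom q r ->
  smoothat (chart q \o param p) (chart p r).
Proof.
move=> pr qr.
have [|F /smooth_extP[sF Ff]] := @transition_smooth _ _ M p q (chart p r).
  by exists r.
apply: smoothat_eq sF.
have := near_chart_dom pr (chart_dom_open q) qr.
apply: filterS2 Ff => u Fu [pu qu]; apply: Fu.
have [pu1 pu2] := param_in pu.
by exists (param p u).
Qed.

Lemma change_chart_comp (a b c q : M) v :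
  chart_dom a q -> chart_dom b q -> chart_dom c q ->
  change_chart b c q (change_chart a b q v) = change_chart a c q v.
Proof.
move=> aq bq cq; rewrite /change_chart.
have s1 := transition_smoothat aq bq; have s2 := transition_smoothat bq cq.
have e : (chart b \o param a) (chart a q) = chart b q by rewrite /= chartK.
have [|_ ] := @derive_comp_diff R _ _ _ (chart b \o param a) (chart c \o param b)
  (chart a q) v (smoothat_derivable s1).
  by rewrite e; exact: smoothat_diff.
rewrite e => <-; apply: near_eq_derive.
have := near_chart_dom aq (chart_dom_open b) bq.
by apply: filterS => u [_ bu]; rewrite /= chartK.
Qed.

Lemma change_chart_id (a q : M) v : chart_dom a q -> change_chart a a q v = v.
Proof.
move=> aq; rewrite /change_chart -[RHS](@derive_id _ _ (chart a q) v).
apply: near_eq_derive.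
have := near_chart_dom aq (chart_dom_open a) aq.
by apply: filterS => u [/param_in[_ +] _].
Qed.

Lemma change_chartK (a b q : M) v : chart_dom a q -> chart_dom b q ->
  change_chart b a q (change_chart a b q v) = v.
Proof. by move=> aq bq; rewrite change_chart_comp // change_chart_id. Qed.

End ManifoldLemmas.

(** * The reduction map and its local sections *)

Section BlockColumns.
Context {R : realType}.
Implicit Types E : normedModType R.

Lemma smoothat_col_mx E m1 m2 n (f : E -> 'M[R]_(m1, n)) (g : E -> 'M[R]_(m2, n)) e :
  smoothat f e -> smoothat g e -> smoothat (fun y => col_mx (f y) (g y)) e.
Proof.
move=> sf sg; apply: smoothat_mx => i j; case: (split_ordP i) => i' ->.
  have -> : (fun y => col_mx (f y) (g y) (lshift m2 i') j : R^o) = (fun y => f y i' j).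
    by apply/funext => y; rewrite col_mxEu.
  exact: smoothat_entry.
have -> : (fun y => col_mx (f y) (g y) (rshift m1 i') j : R^o) = (fun y => g y i' j).
  by apply/funext => y; rewrite col_mxEd.
exact: smoothat_entry.
Qed.

Lemma smoothat_scalar1 E (f : E -> R^o) e :
  smoothat f e -> smoothat (fun y => (f y)%:M : 'M[R]_1) e.
Proof.
move=> sf; apply: smoothat_mx => i j.
have -> : (fun y => (f y)%:M i j : R^o) = f.
  by apply/funext => y; rewrite !ord1 mxE eqxx mulr1n.
exact: sf.
Qed.

Lemma is_derive_col_mx E m1 m2 n (f : E -> 'M[R]_(m1, n)) (g : E -> 'M[R]_(m2, n))
    (x v : E) df dg :
  is_derive x v f df -> is_derive x v g dg ->
  is_derive x v (fun y => col_mx (f y) (g y)) (col_mx df dg).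
Proof.
move=> [df1 df2] [dg1 dg2].
have d : derivable (fun y => col_mx (f y) (g y)) x v.
  apply/derivable_mxP => i j; case: (split_ordP i) => i' ->.
    have -> : (fun y => col_mx (f y) (g y) (lshift m2 i') j) = (fun y => f y i' j).
      by apply/funext => y; rewrite col_mxEu.
    by move/derivable_mxP : df1; exact.
  have -> : (fun y => col_mx (f y) (g y) (rshift m1 i') j) = (fun y => g y i' j).
    by apply/funext => y; rewrite col_mxEd.
  by move/derivable_mxP : dg1; exact.
split => //; rewrite derive_mx // -df2 -dg2 !derive_mx //.
apply/matrixP => i j; rewrite mxE; case: (split_ordP i) => i' ->.
  rewrite col_mxEu mxE; congr ('D_v _ x).
  by apply/funext => y; rewrite col_mxEu.
rewrite col_mxEd mxE; congr ('D_v _ x).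
by apply/funext => y; rewrite col_mxEd.
Qed.

Lemma is_derive_scalar1 E (f : E -> R^o) (x v : E) (df : R) :
  is_derive x v f df -> is_derive x v (fun y => (f y)%:M : 'M[R]_1) df%:M.
Proof.
move=> [df1 df2].
have e i j : (fun y => ((f y)%:M : 'M[R]_1) i j) = f.
  by apply/funext => y; rewrite !ord1 mxE eqxx mulr1n.
have d : derivable (fun y => (f y)%:M : 'M[R]_1) x v.
  by apply/derivable_mxP => i j; rewrite e.
split => //; rewrite derive_mx //; apply/matrixP => i j.
by rewrite !mxE e df2 !ord1 eqxx mulr1n.
Qed.

Lemma smoothat_jacobian N m (f : 'cV[R]_N -> 'cV[R]_m) x :
  smoothat f x -> smoothat (jacobian_mx f) x.
Proof.
move=> sf; apply: smoothat_mx => i j.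
have -> : (fun y => jacobian_mx f y i j : R^o) = (fun y => 'D_(ecol j) f y i 0).
  by apply/funext => y; rewrite mxE.
by apply: smoothat_entry; exact: smoothat_derive.
Qed.

Lemma smooth_ext_near (V W : normedModType R) (S : set V) (f : V -> W) x F :
  smooth_ext S f x F -> \forall y \near x, smooth_ext S f y F.
Proof.
by move=> [U [oU Ux CF Ff]]; apply: (open_near oU Ux) => y Uy; exists U.
Qed.

Lemma mulmx1_eqC m n (Q : 'M[R]_(m, n)) (P : 'M[R]_(n, m)) :
  m = n -> Q *m P = 1%:M -> P *m Q = 1%:M.
Proof. by move=> e; case: n / e Q P => Q P; exact: mulmx1C. Qed.

End BlockColumns.

Section Submersion.
Context {R : realType} {n : nat}.
Notation V := 'cV[R]_(n.+1 + n.+1).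
Variables (A : 'M[R]_(n.+1 + n.+1)) (lambda : R).
Hypotheses (hA : in_sp A) (hA2 : A *m A = lambda%:M).
Context {M : smooth_manifold R n.*2}.
Variables (proj : V -> M) (hM : quotient_submersion A proj).
Implicit Types (x v w : V) (p q : M).

Lemma proj_ext0 x : Sigma A x ->
  exists F, smooth_ext (Sigma A) (chart (proj x) \o proj) x F.
Proof. by case: hM => _ _ sm _ hx; have [_] := sm x hx. Qed.

(** Continuity of the projection on the hypersurface: near x it is a parametrisation
    of M composed with a smooth extension. *)
Lemma near_proj x (O : set M) : Sigma A x -> open O -> O (proj x) ->
  \forall y \near x, Sigma A y -> O (proj y).
Proof.
move=> hx oO Ox; case: hM => _ _ /(_ x hx)[[U [oU Ux HU]] [F /smooth_extP[sF Ff]]] _.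
have Fx : F x = chart (proj x) (proj x) by have := nbhs_singleton Ff; exact.
have cF := smoothat_continuous sF.
have /= := near_chart_dom (chart_dom_center (proj x)) oO Ox.
rewrite -Fx => H.
have H' : \forall y \near x, O (param (proj x) (F y)).
  apply: (cF (fun u => O (param (proj x) u))).
  by apply: filterS H => u [].
have HUn : \forall y \near x, U y by exact: open_nbhs_nbhs.
near=> y => Sy.
have -> : proj y = param (proj x) (F y).
  rewrite (near Ff y) //= chartK //; apply: HU => //.
  by near: y.
by near: y.
Unshelve. all: by end_near. Qed.

Lemma proj_ext_comp x p q F : Sigma A x -> chart_dom q (proj x) ->
  chart_dom p (proj x) -> smooth_ext (Sigma A) (chart q \o proj) x F ->
  smooth_ext (Sigma A) (chart p \o proj) x ((chart p \o param q) \o F).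
Proof.
move=> hx qx px /smooth_extP[sF Ff]; apply/smooth_extP.
have Fx : F x = chart q (proj x) by have := nbhs_singleton Ff; exact.
split.
  apply: smoothat_comp => //; rewrite Fx; exact: transition_smoothat.
have H := near_proj hx (chart_dom_open q) qx.
near=> y => Sy; rewrite /= (near Ff y) //= chartK //.
by apply: (near H y).
Unshelve. all: by end_near. Qed.

Lemma proj_ext x p : Sigma A x -> chart_dom p (proj x) ->
  exists F, smooth_ext (Sigma A) (chart p \o proj) x F.
Proof.
move=> hx px; have [F hF] := proj_ext0 hx.
by exists ((chart p \o param (proj x)) \o F); exact: (proj_ext_comp hx (chart_dom_center _) px hF).
Qed.

Lemma diff_projE x v F : Sigma A x -> tangent_Sigma A x v ->
  smooth_ext (Sigma A) (chart (proj x) \o proj) x F ->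
  diff_proj A proj x v = 'D_v F x.
Proof. by move=> hx hv hF; exact: (derive_onE hA). Qed.

(** [diff_proj] uses the chart attached to the image point, which varies with x;
    smoothness has to be read in one fixed chart p. *)
Lemma derive_proj_ext x v p F : Sigma A x -> tangent_Sigma A x v ->
  chart_dom p (proj x) -> smooth_ext (Sigma A) (chart p \o proj) x F ->
  'D_v F x = change_chart (proj x) p (proj x) (diff_proj A proj x v).
Proof.
move=> hx hv px hF; have [F0 hF0] := proj_ext0 hx.
have hF' := proj_ext_comp hx (chart_dom_center _) px hF0.
rewrite -(derive_onE hA hx hv hF) (derive_onE hA hx hv hF').
rewrite (diff_projE hx hv hF0).
have [sF0 F0f] := (smooth_extP _ _ _ _).1 hF0.
have Fx : F0 x = chart (proj x) (proj x) by have := nbhs_singleton F0f; exact.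
have [|_ ->] := @derive_comp_diff R _ _ _ F0 (chart p \o param (proj x)) x v
  (smoothat_derivable sF0); last by rewrite /change_chart Fx.
rewrite Fx; apply: smoothat_diff; apply: transition_smoothat => //.
exact: chart_dom_center.
Qed.

Definition flow (t : R) : 'M[R]_(n.+1 + n.+1) :=
  (cosA lambda t)%:M + sinA lambda t *: A.

Lemma flowE t x : flow t *m x = cosA lambda t *: x + sinA lambda t *: (A *m x).
Proof. by rewrite /flow mulmxDl mul_scalar_mx scalemxAl. Qed.

Lemma flow_Sigma t x : Sigma A x -> Sigma A (flow t *m x).
Proof.
move=> hx; rewrite /Sigma /= flowE mulmxDr -!scalemxAr.
by rewrite (flow_Omega hA hA2) //; exact: cosA_sinA.
Qed.

Lemma proj_eqP x y : Sigma A x -> Sigma A y ->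
  (proj x = proj y <-> exists t, y = flow t *m x).
Proof.
move=> hx hy; case: hM => _ /(_ x y hx hy) -> _ _.
by split=> -[t ->]; exists t; rewrite /flow -(expmx_quadratic hA2).
Qed.

Lemma proj_flow t x : Sigma A x -> proj (flow t *m x) = proj x.
Proof.
by move=> hx; apply/esym/proj_eqP => //; [exact: flow_Sigma|exists t].
Qed.

(** The projection is constant along t |-> exp (t A) x, whose velocity at 0 is
    A x. *)
Lemma derive_proj_vertical x p F : Sigma A x -> chart_dom p (proj x) ->
  smooth_ext (Sigma A) (chart p \o proj) x F -> 'D_(A *m x) F x = 0.
Proof.
move=> hx px hF; have [sF Ff] := (smooth_extP _ _ _ _).1 hF.
rewrite -[RHS](@derive_cst R _ _ (chart p (proj x)) x (A *m x)).
have dc := @is_derive_cosA R lambda 0; have ds := @is_derive_sinA R lambda 0.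
apply: (@curve_derive_unique _ _ _ [set y | Sigma A y /\ proj y = proj x] _ _ _ _
  (fun t => cosA lambda t *: x + sinA lambda t *: (A *m x))).
- by rewrite cosA0 sinA0 scale1r scale0r addr0.
- have := is_derive_lincomb x (A *m x) dc ds.
  by rewrite cosA0 sinA0 mulr0 scale0r scale1r add0r.
- apply: filterE => t /=; rewrite -flowE; split; [exact: flow_Sigma|exact: proj_flow].
- exact: smoothat_diff.
- exact: differentiable_cst.
- by near=> y => -[Sy py]; rewrite (near Ff y) //= py.
Unshelve. all: by end_near. Qed.

Lemma hor_proj_tangent x v : Sigma A x -> tangent_Sigma A x v ->
  hor_proj A x v = v + Omega v x *: (A *m x).
Proof. by move=> hx /(tangent_SigmaP hA) hv; rewrite /hor_proj hv scale0r subr0. Qed.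

Lemma horizontal_tangent x v : horizontal A x v -> tangent_Sigma A x v.
Proof. by move=> [_ h]; exact/(tangent_SigmaP hA). Qed.

(** A tangent vector differs from its horizontal part by a multiple of A x, which
    the projection kills. *)
Lemma derive_proj_surj x p F (w : 'cV[R]_n.*2) : Sigma A x ->
  chart_dom p (proj x) -> smooth_ext (Sigma A) (chart p \o proj) x F ->
  exists2 v, horizontal A x v & 'D_v F x = w.
Proof.
move=> hx px hF; case: hM => _ _ _ /(_ x hx (change_chart p (proj x) (proj x) w)).
move=> [v0 tv0 v0w]; exists (hor_proj A x v0); first exact: (hor_proj_horizontal hx).
have [sF _] := (smooth_extP _ _ _ _).1 hF.
have dF := smoothat_diff sF.
rewrite (hor_proj_tangent hx tv0) jacobian_mxE // mulmxDr -scalemxAr.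
rewrite -!jacobian_mxE // (derive_proj_vertical hx px hF) scaler0 addr0.
rewrite (derive_proj_ext hx tv0 px hF) v0w change_chartK //.
exact: chart_dom_center.
Qed.

(** The derivative at x of (F, q / 2, Omega (-, x)), where q y = Omega y (A y): a
    matrix of size 2n + 2, although the two dimensions have different forms. *)
Definition slice_mx (F : V -> 'cV[R]_n.*2) x : 'M[R]_(n.*2 + (1 + 1), n.+1 + n.+1) :=
  col_mx (jacobian_mx F x) (col_mx (Jmx *m (A *m x))^T (Jmx *m x)^T).

Lemma row_Omega1 v w : (Jmx *m w)^T *m v = (Omega v w)%:M.
Proof.
rewrite [LHS]mx11_scalar; congr (_%:M).
by rewrite trmx_mul Jmx_tr mulmxN mulNmx mxE OmegaC.
Qed.

Lemma slice_mxE F x v : smoothat F x -> slice_mx F x *m v =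
  col_mx ('D_v F x) (col_mx (Omega v (A *m x))%:M (Omega v x)%:M).
Proof.
move=> sF; rewrite /slice_mx 2!mul_col_mx !row_Omega1 -jacobian_mxE //.
exact: smoothat_diff.
Qed.

(** Horizontal vectors reach the first block and the plane of x and A x the last
    two rows. A surjective square matrix is invertible. *)
Lemma slice_mx_inv x p F : Sigma A x -> chart_dom p (proj x) ->
  smooth_ext (Sigma A) (chart p \o proj) x F ->
  exists B, B *m slice_mx F x = 1%:M /\ slice_mx F x *m B = 1%:M.
Proof.
move=> hx px hF; have [sF _] := (smooth_extP _ _ _ _).1 hF.
have dF := smoothat_diff sF.
have surj (w : 'cV[R]_(n.*2 + (1 + 1))) : exists v, slice_mx F x *m v = w.
  pose a := usubmx (dsubmx w) 0 0; pose b := dsubmx (dsubmx w) 0 0.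
  pose z := a *: x - b *: (A *m x).
  have [h [h1 h2] hw] := derive_proj_surj (usubmx w - 'D_z F x) hx px hF.
  exists (h + z); rewrite slice_mxE // /z !OmegaE h1 h2 -/z !Omegaxx (Sigma1 hx).
  rewrite (hx : Omega x (A *m x) = 1).
  rewrite jacobian_mxE // mulmxDr -!jacobian_mxE // hw subrK.
  rewrite !mulr0 mulr1 !add0r oppr0 addr0 mulrN1 opprK.
  by rewrite -!mx11_scalar !vsubmxK.
pose f j := sval (cid (surj (delta_mx j 0))).
pose B : 'M[R]_(n.+1 + n.+1, n.*2 + (1 + 1)) := \matrix_(i, j) (f j) i 0.
have B1 : slice_mx F x *m B = 1%:M.
  apply/matrixP => i j.
  have := svalP (cid (surj (delta_mx j 0))); rewrite -/(f j) => /matrixP /(_ i 0).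
  rewrite !mxE andbT => <-; apply: eq_bigr => l _.
  by rewrite [B _ _]mxE.
exists B; split => //; apply: mulmx1_eqC B1.
by rewrite -addnn addnA !addn1 addSn addnS.
Qed.

(** The inverse function theorem for the map (F, q / 2, Omega (-, x0)), with F an
    extension of the projection read in the chart p, solves F = u on the slice
    q = 1, Omega (-, x0) = 0. The last equation makes the section transverse to
    the flow, and serves to show that fixed points of symmetries are isolated. *)
Lemma local_section x0 p : Sigma A x0 -> chart_dom p (proj x0) ->
  exists tau : 'cV[R]_n.*2 -> V,
    [/\ smoothat tau (chart p (proj x0)), tau (chart p (proj x0)) = x0 &
    \forall u \near chart p (proj x0),
      [/\ Sigma A (tau u), proj (tau u) = param p u & Omega (tau u) x0 = 0]].
Proof.
move=> hx px; have [F hF] := proj_ext hx px.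
have [sF Ff] := (smooth_extP _ _ _ _).1 hF.
have Fx : F x0 = chart p (proj x0) by have := nbhs_singleton Ff; exact.
have [B [BM MB]] := slice_mx_inv hx px hF.
pose q (y : V) : R^o := Omega y (A *m y).
pose h (u : 'cV[R]_n.*2) (a b : R) : V := B *m col_mx u (col_mx a%:M b%:M).
have hinj u a b u' a' b' : h u a b = h u' a' b' -> [/\ u = u', a = a' & b = b'].
  move=> /(congr1 (mulmx (slice_mx F x0))); rewrite /h !mulmxA MB !mul1mx.
  move=> /eq_col_mx[-> /eq_col_mx[/matrixP /(_ 0 0) + /matrixP /(_ 0 0)]].
  by rewrite !mxE !eqxx !mulr1n.
(* the factor 1/2 compensates D_v q x0 = 2 * Omega v (A *m x0) *)
pose G (y : V) : V := h (F y) (2^-1 * q y) (Omega y x0).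
have sq y : smoothat q y.
  by apply: smoothat_Omega; [exact: smoothat_id|apply: smoothat_mulmxl; exact: smoothat_id].
have sG : smoothat G x0.
  apply: smoothat_mulmxl; apply: smoothat_col_mx => //; apply: smoothat_col_mx.
    apply: smoothat_scalar1; apply: (@smoothatM _ _ (cst (2^-1 : R^o)) q) => //.
    exact: smoothat_cst.
  apply: smoothat_scalar1; apply: smoothat_Omega; [exact: smoothat_id|exact: smoothat_cst].
have DG v : 'D_v G x0 = v.
  have d1 : is_derive x0 v F ('D_v F x0) by apply: derivableP; exact: smoothat_derivable.
  have d2 : is_derive x0 v (fun y => 2^-1 * q y : R^o) (Omega v (A *m x0)).
    have dq := is_derive_Sigma hA x0 v.
    have -> : Omega v (A *m x0) = 2^-1 *: (2 * Omega v (A *m x0) : R^o).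
      by rewrite /GRing.scale /= mulrA mulVf ?mul1r.
    exact: is_deriveZ.
  have d3 : is_derive x0 v (fun y => Omega y x0 : R^o) (Omega v x0).
    apply: (@is_derive_quadratic _ _ _ _ _ _ 0) => t.
    by rewrite !OmegaE mulr0 addr0 addrC.
  have d4 := is_derive_col_mx d1
    (is_derive_col_mx (is_derive_scalar1 d2) (is_derive_scalar1 d3)).
  have [d41 d42] := d4.
  have [_ ->] := linear_comp_derive (@linear_cV_continuous _ _ _ (mulmx B)) d41.
  by rewrite d42 /= -(slice_mxE _ sF) mulmxA BM mul1mx.
have [K [K0 sK GK]] := inverse_function sG DG.
pose tau u := K (h u 2^-1 0).
have G0 : G x0 = h (chart p (proj x0)) 2^-1 0.
  by rewrite /G Fx /q (hx : Omega x0 (A *m x0) = 1) mulr1 Omegaxx.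
have sh : smoothat (fun u => h u 2^-1 0) (chart p (proj x0)).
  apply: smoothat_mulmxl; apply: smoothat_col_mx; first exact: smoothat_id.
  exact: smoothat_cst.
have stau : smoothat tau (chart p (proj x0)).
  by apply: (smoothat_comp sh); rewrite -G0.
have tau0 : tau (chart p (proj x0)) = x0 by rewrite /tau -G0.
exists tau; split => //.
have ctau := smoothat_continuous stau.
have N1 : \forall u \near chart p (proj x0), G (tau u) = h u 2^-1 0.
  have := smoothat_continuous sh => ch.
  apply: (ch (fun z => G (K z) = z)); rewrite -G0; exact: GK.
have N2 : \forall u \near chart p (proj x0),
    Sigma A (tau u) -> F (tau u) = chart p (proj (tau u)) /\ chart_dom p (proj (tau u)).
  apply: (ctau (fun y => Sigma A y -> F y = chart p (proj y) /\ chart_dom p (proj y))).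
  rewrite tau0; have Hd := near_proj hx (chart_dom_open p) px.
  by apply: filterS2 Ff Hd => y H1 H2 Sy; split; [exact: H1|exact: H2].
apply: filterS2 N1 N2 => u /hinj[Fu qu Ou] H2.
have Su : Sigma A (tau u).
  apply: (mulfI (_ : 2^-1 != 0 :> R)); first by rewrite invr_eq0.
  by rewrite mulr1.
have [F1 F2] := H2 Su.
split => //; have -> : param p u = param p (F (tau u)) by rewrite Fu.
by rewrite F1 chartK.
Qed.

End Submersion.

(** * Horizontal lifts *)

Section Lifts.
Context {R : realType} {n : nat}.
Notation V := 'cV[R]_(n.+1 + n.+1).
Variables (A : 'M[R]_(n.+1 + n.+1)) (lambda : R).
Hypotheses (hA : in_sp A) (hA2 : A *m A = lambda%:M).
Context {M : smooth_manifold R n.*2}.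
Variables (proj : V -> M) (hM : quotient_submersion A proj).
Implicit Types (x v w : V) (p q : M).

Local Notation hor_lift := (horizontal_lift A proj).
Local Notation dproj := (diff_proj A proj).

Lemma hor_lift_exists x (w : 'cV[R]_n.*2) : Sigma A x -> exists v, hor_lift x v w.
Proof.
move=> hx; have [F hF] := proj_ext0 hM hx.
have [v hv vw] := derive_proj_surj hA hA2 hM w hx (chart_dom_center _) hF.
exists v; split => //; rewrite (diff_projE hA hx _ hF) //.
exact: horizontal_tangent.
Qed.

Lemma hor_lift_uniq x v v' (w : 'cV[R]_n.*2) : Sigma A x ->
  hor_lift x v w -> hor_lift x v' w -> v = v'.
Proof.
move=> hx [hv vw] [hv' vw']; have [F hF] := proj_ext0 hM hx.
have [sF _] := (smooth_extP _ _ _ _).1 hF.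
have [B [BM _]] := slice_mx_inv hA hA2 hM hx (chart_dom_center _) hF.
have E z : hor_lift x z w -> z = B *m col_mx w (col_mx 0 0).
  move=> [hz zw]; have := diff_projE hA hx (horizontal_tangent hA hz) hF.
  rewrite zw => wE; have [z1 z2] := hz.
  rewrite -[LHS]mul1mx -BM -mulmxA (slice_mxE _ _ sF) -wE z1 z2.
  by rewrite -scalemx1 scale0r.
by rewrite (E v) // (E v').
Qed.

Definition hlift x (w : 'cV[R]_n.*2) : V := xget 0 [set v | hor_lift x v w].

Lemma hliftP x (w : 'cV[R]_n.*2) : Sigma A x -> hor_lift x (hlift x w) w.
Proof.
move=> hx; have [v hv] := hor_lift_exists w hx.
by apply: (@xgetPex _ 0 [set v | hor_lift x v w]); exists v.
Qed.

Lemma dproj_linear x a v w : Sigma A x -> horizontal A x v -> horizontal A x w ->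
  dproj x (a *: v + w) = a *: dproj x v + dproj x w.
Proof.
move=> hx hv hw; have [F hF] := proj_ext0 hM hx.
have [sF _] := (smooth_extP _ _ _ _).1 hF; have dF := smoothat_diff sF.
have hvw : horizontal A x (a *: v + w).
  have [v1 v2] := hv; have [w1 w2] := hw.
  by split; rewrite !OmegaE ?v1 ?v2 ?w1 ?w2 mulr0 addr0.
rewrite !(diff_projE hA hx _ hF); try exact: horizontal_tangent.
by rewrite !jacobian_mxE // mulmxDr scalemxAr.
Qed.

Definition lifts (X' : V -> V) (X : M -> 'cV[R]_n.*2) : Prop :=
  forall x, Sigma A x -> hor_lift x (X' x) (X (proj x)).

(** The lift is the solution v of the linear system slice_mx v = (X, 0, 0), whose
    matrix depends smoothly on the point; multiplied by its inverse B at x0 it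
    becomes a square matrix that stays invertible near x0. *)
Lemma lift_smooth X X' : smooth_vf X -> lifts X' X -> smooth_on (Sigma A) X'.
Proof.
move=> sX lX x0 hx; pose p := proj x0.
have px : chart_dom p (proj x0) by exact: chart_dom_center.
have [F hF] := proj_ext hM hx px.
have [sF Ff] := (smooth_extP _ _ _ _).1 hF.
have Fx : F x0 = chart p (proj x0) by have := nbhs_singleton Ff; exact.
have [B [BM MB]] := slice_mx_inv hA hA2 hM hx px hF.
pose xi u := change_chart (param p u) p (param p u) (X (param p u)).
have sxi : smoothat xi (chart p (proj x0)).
  by apply: smooth_on_open (sX p); [exact: chart_codom_open|exact: chart_in].
pose N x := B *m slice_mx A F x.
have sN : smoothat N x0.
  apply: smoothat_mulmx; first exact: smoothat_cst.
  apply: smoothat_col_mx; first exact: smoothat_jacobian.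
  apply: smoothat_col_mx; apply: smoothat_trmx; apply: smoothat_mulmxl.
    by apply: smoothat_mulmxl; exact: smoothat_id.
  exact: smoothat_id.
have NU : N x0 \in unitmx by rewrite /N BM unitmx1.
exists (fun x => invmx (N x) *m (B *m col_mx (xi (F x)) 0)).
apply/smooth_extP; split.
  apply: smoothat_mulmx; first exact: smoothat_invmx.
  apply: smoothat_mulmxl; apply: smoothat_col_mx; last exact: smoothat_cst.
  by apply: (smoothat_comp sF); rewrite Fx.
have H1 := unitmx_near sN NU.
have H2 := smooth_ext_near hF.
have H3 := near_proj hM hx (chart_dom_open p) px.
have H4 := smoothat_near sF.
near=> x => Sx.
have pxx : chart_dom p (proj x) by apply: (near H3 x).
have hFx : smooth_ext (Sigma A) (chart p \o proj) x F by near: x.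
have NxU : N x \in unitmx by near: x.
have [hX dX] := lX x Sx; have [h1 h2] := hX.
have E : N x *m X' x = B *m col_mx (xi (F x)) 0.
  have sFx : smoothat F x by near: x.
  rewrite /N -mulmxA (slice_mxE _ _ sFx) h1 h2.
  rewrite (derive_proj_ext hA hM Sx (horizontal_tangent hA hX) pxx hFx) dX.
  have -> : F x = chart p (proj x) by apply: (near Ff x).
  by rewrite /xi chartK // -[0%:M]scalemx1 scale0r col_mx0.
by rewrite -E mulmxA mulVmx // mul1mx.
Unshelve. all: by end_near. Qed.

Lemma local_section_codom p (u0 : 'cV[R]_n.*2) : chart_codom p u0 ->
  exists x0, [/\ Sigma A x0, chart_dom p (proj x0) & chart p (proj x0) = u0].
Proof.
move=> /param_in[pu pK]; case: hM => /(_ (param p u0))[x0 hx x0u] _ _ _.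
by exists x0; rewrite x0u.
Qed.

(** Read in a chart, X is the derivative of the projection applied to the lift,
    along a local section. *)
Lemma descend_vf X X' : smooth_on (Sigma A) X' -> lifts X' X -> smooth_vf X.
Proof.
move=> sX' lX p u0 /local_section_codom[x0 [hx px <-{u0}]].
have [F hF] := proj_ext hM hx px.
have [sF Ff] := (smooth_extP _ _ _ _).1 hF.
have [tau [stau tau0 Htau]] := local_section hA hA2 hM hx px.
have [X'' /smooth_extP[sX'' X''E]] := sX' x0 hx.
exists (fun u => jacobian_mx F (tau u) *m X'' (tau u)).
apply/smooth_extP; split.
  apply: smoothat_mulmx.
    by apply: (smoothat_comp stau); rewrite tau0; exact: smoothat_jacobian.
  by apply: (smoothat_comp stau); rewrite tau0.
have ctau := smoothat_continuous stau.
have H : \forall u \near chart p (proj x0), [/\ smooth_ext (Sigma A) (chart p \o proj) (tau u) F,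
    Sigma A (tau u) -> X'' (tau u) = X' (tau u) &
    Sigma A (tau u) -> chart_dom p (proj (tau u))].
  apply: (ctau (fun y => [/\ smooth_ext (Sigma A) (chart p \o proj) y F,
    Sigma A y -> X'' y = X' y & Sigma A y -> chart_dom p (proj y)])).
  rewrite tau0; have H1 := smooth_ext_near hF.
  have H2 := near_proj hM hx (chart_dom_open p) px.
  by near=> y; split; near: y.
apply: filterS2 H Htau => u [hFu X''u pu] [Su tauu _] _.
have [hX dX] := lX _ Su.
have [sFu _] := (smooth_extP _ _ _ _).1 hFu.
rewrite X''u // -jacobian_mxE; last exact: smoothat_diff.
rewrite (derive_proj_ext hA hM Su (horizontal_tangent hA hX) (pu Su) hFu) dX.
by rewrite tauu.
Unshelve. all: by end_near. Qed.

Lemma descend_fun (f : M -> R) (phi : V -> R^o) : smooth_on (Sigma A) phi ->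
  (forall x, Sigma A x -> f (proj x) = phi x) -> smooth_fun f.
Proof.
move=> sphi fphi p u0 /local_section_codom[x0 [hx px <-{u0}]].
have [tau [stau tau0 Htau]] := local_section hA hA2 hM hx px.
have [phi' /smooth_extP[sphi' phi'E]] := sphi x0 hx.
exists (phi' \o tau); apply/smooth_extP; split.
  by apply: smoothat_compR stau _; rewrite tau0.
have ctau := smoothat_continuous stau.
have H : \forall u \near chart p (proj x0), Sigma A (tau u) -> phi' (tau u) = phi (tau u).
  by apply: (ctau (fun y => Sigma A y -> phi' y = phi y)); rewrite tau0.
apply: filterS2 H Htau => u H [Su tauu _] _.
by rewrite /= H // -tauu fphi.
Qed.

(** Maps into M are shown to be smooth by lifting them to the vector space. *)
Lemma smooth_into_proj (E : normedModType R) (S : set E) (f : E -> M) :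
  (forall e, S e -> exists h : E -> V, smoothat h e /\
     \forall y \near e, S y -> Sigma A (h y) /\ f y = proj (h y)) ->
  smooth_into S f.
Proof.
move=> H e Se; have [h [sh Hh]] := H e Se.
have [She fhe] : Sigma A (h e) /\ f e = proj (h e) by have := nbhs_singleton Hh; exact.
have ch := smoothat_continuous sh.
have [F hF] := proj_ext0 hM She; have [sF Ff] := (smooth_extP _ _ _ _).1 hF.
have H1 : \forall y \near e, Sigma A (h y) -> chart_dom (f e) (proj (h y)).
  apply: (ch (fun z => Sigma A z -> chart_dom (f e) (proj z))).
  rewrite fhe; apply: (near_proj hM She); first exact: chart_dom_open.
  exact: chart_dom_center.
have H2 : \forall y \near e, Sigma A (h y) -> F (h y) = chart (f e) (proj (h y)).
  by rewrite fhe; apply: (ch (fun z => Sigma A z -> F z = chart (proj (h e)) (proj z))).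
split.
  have : \forall y \near e, S y -> chart_dom (f e) (f y).
    apply: filterS2 Hh H1 => y H3 H4 Sy; have [S1 ->] := H3 Sy; exact: H4.
  by move=> /near_open[U [oU Ue HU]]; exists U.
exists (F \o h); apply/smooth_extP; split; first exact: smoothat_comp.
apply: filterS2 Hh H2 => y H3 H4 Sy; have [S1 /= ->] := H3 Sy; exact: H4.
Qed.

End Lifts.

(** * The symmetries of the quotient *)

Section Factors.
Context {R : realType} {a b m : nat}.
Implicit Type e : 'cV[R]_a * 'cV[R]_b.

Lemma smoothat_fst (f : 'cV[R]_a -> 'cV[R]_m) e :
  smoothat f e.1 -> smoothat (fun u : 'cV[R]_a * 'cV[R]_b => f u.1) e.
Proof.
pose L : {linear ('cV[R]_a * 'cV[R]_b)%type -> 'cV[R]_a} := fst.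
have cL : continuous (fst : 'cV[R]_a * 'cV[R]_b -> 'cV[R]_a).
  by move=> z; exact: (@cvg_fst _ _ (nbhs z.1) (nbhs z.2)).
move=> sf; exact: (@smoothat_comp_linear R _ _ _ L f e cL sf).
Qed.

Lemma smoothat_snd (f : 'cV[R]_b -> 'cV[R]_m) e :
  smoothat f e.2 -> smoothat (fun u : 'cV[R]_a * 'cV[R]_b => f u.2) e.
Proof.
pose L : {linear ('cV[R]_a * 'cV[R]_b)%type -> 'cV[R]_b} := snd.
have cL : continuous (snd : 'cV[R]_a * 'cV[R]_b -> 'cV[R]_b).
  by move=> z; exact: (@cvg_snd _ _ (nbhs z.1) (nbhs z.2)).
move=> sf; exact: (@smoothat_comp_linear R _ _ _ L f e cL sf).
Qed.

End Factors.

Lemma smoothat_sym_mx (R : realType) k (A : 'M[R]_(k + k)) (E : normedModType R)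
    (h1 h2 : E -> 'cV[R]_(k + k)) (e : E) :
  smoothat h1 e -> smoothat h2 e -> smoothat (fun u => sym_mx A (h1 u) *m h2 u) e.
Proof.
move=> s1 s2.
have sA1 : smoothat (fun u => A *m h1 u) e by exact: smoothat_mulmxl.
have sO g : smoothat g e -> smoothat (fun u => 2 * Omega (h2 u) (g u) : R^o) e.
  move=> sg; exact: (smoothatM (smoothat_cst (2 : R^o) e) (smoothat_Omega s2 sg)).
pose f1 := fun u => - h2 u.
pose f2 := fun u => (2 * Omega (h2 u) (A *m h1 u)) *: h1 u.
pose f3 := fun u => - ((2 * Omega (h2 u) (h1 u)) *: (A *m h1 u)).
have -> : (fun u => sym_mx A (h1 u) *m h2 u) = f1 + (f2 + f3).
  by apply/funext => u; rewrite sym_mxE.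
have S1 : smoothat f1 e by exact: smoothatN s2.
have S2 : smoothat f2 e by exact: smoothatZ (sO _ sA1) s1.
have S3 : smoothat f3 e by exact: smoothatN (smoothatZ (sO _ s1) sA1).
exact: smoothatD S1 (smoothatD S2 S3).
Qed.

Section Symmetries.
Context {R : realType} {n : nat}.
Notation V := 'cV[R]_(n.+1 + n.+1).
Variables (A : 'M[R]_(n.+1 + n.+1)) (lambda : R).
Hypotheses (hA : in_sp A) (hA2 : A *m A = lambda%:M).
Context {M : smooth_manifold R n.*2}.
Variables (proj : V -> M) (hM : quotient_submersion A proj).
Implicit Types (x v w : V) (p q : M).

Local Notation hor_lift := (horizontal_lift A proj).
Local Notation dproj := (diff_proj A proj).

Definition orbit_rep p : V := xget 0 [set x | Sigma A x /\ proj x = p].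

Lemma orbit_repP p : Sigma A (orbit_rep p) /\ proj (orbit_rep p) = p.
Proof.
case: hM => /(_ p)[x hx xp] _ _ _.
by apply: (@xgetPex _ 0 [set x | Sigma A x /\ proj x = p]); exists x.
Qed.

(** The points of M have no canonical representative on the hypersurface; by
    [sym_mapE] the choice does not matter. *)
Definition sym_map p q : M := proj (sym_mx A (orbit_rep p) *m orbit_rep q).

Lemma sym_mx_flowM x t v :
  sym_mx A x *m (flow A lambda t *m v) = flow A lambda t *m (sym_mx A x *m v).
Proof. by rewrite !flowE mulmxDr -!scalemxAr (sym_mx_A hA hA2). Qed.

Lemma sym_mapE x y : Sigma A x -> Sigma A y ->
  sym_map (proj x) (proj y) = proj (sym_mx A x *m y).
Proof.
move=> hx hy; rewrite /sym_map.
have [hx' ex] := orbit_repP (proj x); have [hy' ey] := orbit_repP (proj y).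
have [t ->] := (proj_eqP hA2 hM hx hx').1 (esym ex).
have [t' ->] := (proj_eqP hA2 hM hy hy').1 (esym ey).
rewrite flowE (sym_mx_flow hA2) ?cosA_sinA // sym_mx_flowM (proj_flow hA hA2 hM) //.
exact: (sym_mx_Sigma hA hA2).
Qed.

Lemma sym_map_smooth p : smooth_self_map (sym_map p).
Proof.
have [hx <-] := orbit_repP p; set x := orbit_rep p in hx *.
move=> q; apply: (smooth_into_proj hM) => u0.
move=> /(local_section_codom hM)[y [hy qy <-{u0}]].
have [tau [stau tau0 Htau]] := local_section hA hA2 hM hy qy.
exists (fun u => sym_mx A x *m tau u); split; first exact: smoothat_mulmxl.
apply: filterS Htau => u [Su tauu _] _; split; first exact: (sym_mx_Sigma hA hA2).
by rewrite /= -tauu sym_mapE.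
Qed.

Lemma sym_mx_tangent x y v : Sigma A x -> tangent_Sigma A y v ->
  tangent_Sigma A (sym_mx A x *m y) (sym_mx A x *m v).
Proof.
move=> hx /(tangent_SigmaP hA) tv; apply/(tangent_SigmaP hA).
by rewrite -(sym_mx_A hA hA2) sym_mx_Omega.
Qed.

(** In charts, both sides differentiate extensions of one and the same map on the
    hypersurface, y |-> proj (S_x y). *)
Lemma diff_map_sym_map x y v : Sigma A x -> Sigma A y -> tangent_Sigma A y v ->
  diff_map (sym_map (proj x)) (proj y) (dproj y v) =
  dproj (sym_mx A x *m y) (sym_mx A x *m v).
Proof.
move=> hx hy tv; set p := proj y; set f := sym_map (proj x); set S := sym_mx A x.
have hSy : Sigma A (S *m y) by exact: (sym_mx_Sigma hA hA2).
have fp : f p = proj (S *m y) by exact: sym_mapE.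
have pp := chart_dom_center p.
pose g := chart (f p) \o f \o param p.
have sg : smoothat g (chart p p).
  have := @sym_map_smooth (proj x) p; rewrite -/f => sf.
  have [_ [G /smooth_extP[sG Gf]]] := sf (chart p p) (chart_in pp).
  apply: smoothat_eq sG.
  have := near_chart_dom pp openT Logic.I.
  apply: filterS2 Gf => u H [cu _]; rewrite H //.
  by rewrite /g /= chartK.
have [F hF] := proj_ext0 hM hy; have [sF Ff] := (smooth_extP _ _ _ _).1 hF.
have [F' hF'] := proj_ext0 hM hSy; have [sF' F'f] := (smooth_extP _ _ _ _).1 hF'.
have Fy : F y = chart p p by have := nbhs_singleton Ff; exact.
rewrite (diff_projE hA hSy (sym_mx_tangent hx tv) hF') (diff_projE hA hy tv hF).
rewrite /diff_map -/g -Fy.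
have dgF : differentiable g (F y) by rewrite Fy; exact: smoothat_diff.
have [_ <-] := derive_comp_diff (smoothat_derivable (v := v) sF) dgF.
have cS : continuous (mulmx S : V -> V) by exact: linear_cV_continuous.
have -> : 'D_(S *m v) F' (S *m y) = 'D_v (F' \o mulmx S) y.
  by rewrite comp_linear_derive.
apply: (Sigma_derive_unique hA hy tv).
- by apply: smoothat_diff; apply: smoothat_comp => //; rewrite Fy.
- by apply: smoothat_diff; exact: (@smoothat_comp_linear _ _ _ _ (mulmx S)).
have N1 := near_proj hM hy (chart_dom_open p) pp.
have N2 : \forall z \near y, Sigma A (S *m z) -> F' (S *m z) = chart (proj (S *m y)) (proj (S *m z)).
  exact: (cS y (fun z => Sigma A z -> F' z = chart (proj (S *m y)) (proj z))).
near=> z => Sz.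
have pz : chart_dom p (proj z) by apply: (near N1 z).
have Fz : F z = chart p (proj z) by apply: (near Ff z).
have F'z : F' (S *m z) = chart (proj (S *m y)) (proj (S *m z)).
  by apply: (near N2 z) => //; exact: (sym_mx_Sigma hA hA2).
by rewrite /= F'z Fz /g /= chartK // fp /f sym_mapE.
Unshelve. all: by end_near. Qed.

Lemma sym_mapK p : involutive (sym_map p).
Proof.
move=> q; have [hx xp] := orbit_repP p; have [hy yq] := orbit_repP q.
rewrite -{1 2}xp -{1}yq !sym_mapE //; last exact: (sym_mx_Sigma hA hA2).
by rewrite sym_mxK.
Qed.

Lemma sym_map_fix p : sym_map p p = p.
Proof.
have [hx xp] := orbit_repP p; rewrite -{1 2}xp sym_mapE // sym_mx_x //.
Qed.

Lemma sym_map_conj p q r : sym_map p (sym_map q (sym_map p r)) = sym_map (sym_map p q) r.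
Proof.
have [hx xp] := orbit_repP p; have [hy yq] := orbit_repP q; have [hz zr] := orbit_repP r.
rewrite -xp -yq -zr !sym_mapE //; try (do ?apply: (sym_mx_Sigma hA hA2) => //).
by rewrite (sym_mx_conj hA hA2).
Qed.

(** A fixed point close to p has a representative z with Omega z x = 0, and
    S_x z = c z + s A z for some c and s. Pairing with x gives s = 0, pairing
    with A x gives c = 1; then z is a multiple of x, hence equal to x. *)
Lemma sym_map_isolated p :
  exists U : set M, [/\ open U, U p & forall q, U q -> sym_map p q = q -> q = p].
Proof.
have [hx xp] := orbit_repP p; set x := orbit_rep p in hx xp.
have pp := chart_dom_center p.
have px : chart_dom p (proj x) by rewrite xp.
have [tau [stau tau0 Htau]] := local_section hA hA2 hM hx px.
rewrite xp in stau tau0 Htau.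
have ctau := smoothat_continuous stau.
have Hpos : \forall u \near chart p p, 0 < Omega (tau u) (A *m x).
  have := smoothat_continuous (smoothat_Omega (smoothat_id x) (smoothat_cst (A *m x) x)).
  move=> cO; apply: (ctau (fun z => 0 < Omega z (A *m x))); rewrite tau0.
  apply: (cO [set t : R | 0 < t]); apply: open_nbhs_nbhs; split; first exact: open_gt.
  by rewrite /= (hx : Omega x (A *m x) = 1).
have cc := chart_continuous pp.
pose P u := [/\ Sigma A (tau u), proj (tau u) = param p u, Omega (tau u) x = 0 &
   0 < Omega (tau u) (A *m x)].
have HP : \forall q \near p, chart_dom p q /\ P (chart p q).
  have H1 : \forall q \near p, chart_dom p q.
    by apply: open_nbhs_nbhs; split; [exact: chart_dom_open|].
  have H2 : \forall q \near p, P (chart p q).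
    by apply: (cc P); apply: filterS2 Htau Hpos => u [].
  exact: filterI H1 H2.
have [U [oU Up UP]] := near_open HP.
exists U; split => // q /UP[pq [Sz zq b0 a0]].
have qz : q = proj (tau (chart p q)) by rewrite zq chartK.
move: Sz b0 a0 qz; set z := tau _ => Sz b0 a0 ->{zq}.
rewrite -{1}xp sym_mapE // => /esym /(proj_eqP hA2 hM Sz (sym_mx_Sigma hA hA2 hx Sz)).
move=> [t]; rewrite sym_mxE b0 mulr0 scale0r subr0 flowE.
set a := Omega z (A *m x) in a0 *; set c := cosA _ _; set s := sinA _ _ => E.
have s0 : s = 0.
  have := congr1 (fun y => Omega y x) E.
  rewrite !OmegaE b0 Omegaxx (OmegaA hA) -/a => H; nra.
have c1 : c = 1.
  have := congr1 (fun y => Omega y (A *m x)) E.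
  by rewrite s0 !OmegaE -/a (hx : Omega x (A *m x) = 1) => H; nra.
have zx : z = a *: x.
  apply/colP => i; move/colP: E => /(_ i).
  by rewrite s0 c1 scale0r addr0 scale1r !mxE => H; lra.
have a1 : a = 1.
  have := Sz; rewrite /Sigma /= zx -scalemxAr !OmegaE (hx : Omega x (A *m x) = 1) mulr1.
  by move=> H; nra.
by rewrite zx a1 scale1r.
Qed.

Lemma sym_map_symplectic (omega : M -> 'cV[R]_n.*2 -> 'cV[R]_n.*2 -> R) p :
  reduced_form A proj omega -> symplectic_diffeo omega (sym_map p).
Proof.
move=> hom; split; first exact: sym_map_smooth.
  by exists (sym_map p); [exact: sym_map_smooth|split; exact: sym_mapK].
move=> q v w; have [hx xp] := orbit_repP p; have [hy yq] := orbit_repP q.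
rewrite -xp -yq; set x := orbit_rep p in hx *; set y := orbit_rep q in hy *.
have [v' hv] := hor_lift_exists hA hA2 hM v hy.
have [w' hw] := hor_lift_exists hA hA2 hM w hy.
have [hv1 hv2] := hv; have [hw1 hw2] := hw.
have Ev := diff_map_sym_map hx hy (horizontal_tangent hA hv1).
have Ew := diff_map_sym_map hx hy (horizontal_tangent hA hw1).
rewrite hv2 in Ev; rewrite hw2 in Ew.
rewrite (hom y v w v' w' hy hv hw) Ev Ew sym_mapE //.
rewrite (hom _ _ _ (sym_mx A x *m v') (sym_mx A x *m w')).
- exact: sym_mx_Omega.
- exact: (sym_mx_Sigma hA hA2).
- split; [exact: (sym_mx_hor_map hA hA2 hx hv1)|exact: erefl].
- split; [exact: (sym_mx_hor_map hA hA2 hx hw1)|exact: erefl].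
Qed.

Lemma sym_map_family : smooth_family sym_map.
Proof.
move=> p q; apply: (smooth_into_proj hM) => -[u1 u2] /= [].
move=> /(local_section_codom hM)[x [hx px <-{u1}]].
move=> /(local_section_codom hM)[y [hy qy <-{u2}]].
have [tau1 [stau1 tau10 Htau1]] := local_section hA hA2 hM hx px.
have [tau2 [stau2 tau20 Htau2]] := local_section hA hA2 hM hy qy.
pose e := (chart p (proj x), chart q (proj y)).
pose h1 (u : 'cV[R]_n.*2 * 'cV[R]_n.*2) := tau1 u.1.
pose h2 (u : 'cV[R]_n.*2 * 'cV[R]_n.*2) := tau2 u.2.
have s1 : smoothat h1 e.
  exact: (@smoothat_fst R _ _ _ tau1 e stau1).
have s2 : smoothat h2 e.
  exact: (@smoothat_snd R _ _ _ tau2 e stau2).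
exists (fun u => sym_mx A (h1 u) *m h2 u); split; first exact: smoothat_sym_mx s1 s2.
have N1 : \forall u \near e, Sigma A (h1 u) /\ proj (h1 u) = param p u.1.
  apply: (@cvg_fst _ _ (nbhs e.1) (nbhs e.2) _ (fun u => Sigma A (tau1 u) /\ proj (tau1 u) = param p u)).
  by apply: filterS Htau1 => u [].
have N2 : \forall u \near e, Sigma A (h2 u) /\ proj (h2 u) = param q u.2.
  apply: (@cvg_snd _ _ (nbhs e.1) (nbhs e.2) _ (fun u => Sigma A (tau2 u) /\ proj (tau2 u) = param q u)).
  by apply: filterS Htau2 => u [].
apply: filterS2 N1 N2 => u [S1 <-] [S2 <-] _.
by split; [exact: (sym_mx_Sigma hA hA2)|rewrite sym_mapE].
Qed.

End Symmetries.

(** * Connections on combinations of vector fields *)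

Section VectorFields.
Context {R : realType} {m : nat} (M : smooth_manifold R m).
Implicit Types (X Y : M -> 'cV[R]_m) (f : M -> R).

Lemma change_chart_linear (a b q : M) : chart_dom a q -> chart_dom b q ->
  linear (change_chart a b q).
Proof.
move=> aq bq; apply: (@derive_linear R _ _ (chart b \o param a)).
by apply: smoothat_diff; exact: transition_smoothat.
Qed.

Lemma smooth_vf_comb f X Y : smooth_fun f -> smooth_vf X -> smooth_vf Y ->
  smooth_vf (fun q => f q *: X q + Y q).
Proof.
move=> sf sX sY p u0 pu0.
have oc := @chart_codom_open _ _ M p.
have sXu := smooth_on_open oc pu0 (sX p).
have sYu := smooth_on_open oc pu0 (sY p).
have sfu := smooth_on_open oc pu0 (sf p).
exists ((fun u => (f \o param p) u *: change_chart (param p u) p (param p u) (X (param p u)))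
  + (fun u => change_chart (param p u) p (param p u) (Y (param p u)))).
apply/smooth_extP; split; first exact: smoothatD (smoothatZ sfu sXu) sYu.
apply: (open_near oc pu0) => u pu _.
have [d1 _] := param_in pu.
by rewrite (change_chart_linear (chart_dom_center _) d1).
Qed.

Lemma smooth_vf0 : smooth_vf (fun _ : M => 0 : 'cV[R]_m).
Proof.
move=> p u pu; exists (cst 0); apply/smooth_extP; split; first exact: smoothat_cst.
by apply: filterE => z _; rewrite /change_chart derive0.
Qed.

Lemma smooth_fun_cst (c : R) : smooth_fun (fun _ : M => c).
Proof.
move=> p u pu; exists (cst c); apply/smooth_extP; split; first exact: smoothat_cst.
exact: filterE.
Qed.

Lemma smooth_vfD X Y : smooth_vf X -> smooth_vf Y -> smooth_vf (fun q => X q + Y q).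
Proof.
move=> sX sY; have := smooth_vf_comb (smooth_fun_cst 1) sX sY.
by under eq_fun do rewrite scale1r.
Qed.

Lemma smooth_vfZ f X : smooth_fun f -> smooth_vf X -> smooth_vf (fun q => f q *: X q).
Proof.
move=> sf sX; have := smooth_vf_comb sf sX smooth_vf0.
by under eq_fun do rewrite addr0.
Qed.

Variable nabla : (M -> 'cV[R]_m) -> (M -> 'cV[R]_m) -> (M -> 'cV[R]_m).
Hypothesis hn : is_connection nabla.

Lemma connection0l Y p : smooth_vf Y -> nabla (fun _ => 0) Y p = 0.
Proof.
move=> sY; case: hn => _ /(_ _ _ Y smooth_vf0 smooth_vf0 sY p) + _ _ _.
under eq_fun do rewrite addr0.
by move=> /eqP; rewrite -subr_eq subrr eq_sym => /eqP.
Qed.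

Lemma connection0r X p : smooth_vf X -> nabla X (fun _ => 0) p = 0.
Proof.
move=> sX; case: hn => _ _ _ /(_ X _ _ sX smooth_vf0 smooth_vf0 p) + _.
under eq_fun do rewrite addr0.
by move=> /eqP; rewrite -subr_eq subrr eq_sym => /eqP.
Qed.

Section Combinations.
Variables (I : Type) (f : I -> M -> R) (E : I -> M -> 'cV[R]_m).
Hypotheses (sf : forall i, smooth_fun (f i)) (sE : forall i, smooth_vf (E i)).

Lemma smooth_vf_sum (r : seq I) : smooth_vf (fun q => \sum_(i <- r) f i q *: E i q).
Proof.
elim: r => [|i r IH].
  by under eq_fun do rewrite big_nil; exact: smooth_vf0.
under eq_fun do rewrite big_cons.
exact: (smooth_vf_comb (sf i) (sE i) IH).
Qed.

Lemma connection_suml (r : seq I) Y p : smooth_vf Y ->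
  nabla (fun q => \sum_(i <- r) f i q *: E i q) Y p =
  \sum_(i <- r) f i p *: nabla (E i) Y p.
Proof.
move=> sY; elim: r => [|i r IH].
  by under eq_fun do rewrite big_nil; rewrite big_nil connection0l.
under eq_fun do rewrite big_cons.
case: hn => _ hD hZ _ _; rewrite big_cons.
apply: (etrans (hD _ _ _ (smooth_vfZ (sf i) (sE i)) (smooth_vf_sum r) sY p)).
by congr (_ + _); [exact: (hZ _ _ _ (sf i) (sE i) sY)|exact: IH].
Qed.

Lemma connection_sumr (r : seq I) X p : smooth_vf X ->
  nabla X (fun q => \sum_(i <- r) f i q *: E i q) p =
  \sum_(i <- r) (vf_apply X (f i) p *: E i p + f i p *: nabla X (E i) p).
Proof.
move=> sX; elim: r => [|i r IH].
  by under eq_fun do rewrite big_nil; rewrite big_nil connection0r.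
under eq_fun do rewrite big_cons.
case: hn => _ _ _ hD hZ; rewrite big_cons.
apply: (etrans (hD _ _ _ sX (smooth_vfZ (sf i) (sE i)) (smooth_vf_sum r) p)).
by congr (_ + _); [exact: (hZ _ _ _ (sf i) sX (sE i))|exact: IH].
Qed.

End Combinations.
End VectorFields.

(** * Invariance of the reduced connection *)

Section Canonical.
Context {R : realType} {n : nat}.
Notation V := 'cV[R]_(n.+1 + n.+1).
Variables (A : 'M[R]_(n.+1 + n.+1)) (lambda : R).
Hypotheses (hA : in_sp A) (hA2 : A *m A = lambda%:M).
Context {M : smooth_manifold R n.*2}.
Variables (proj : V -> M) (hM : quotient_submersion A proj).
Implicit Types (x v w : V) (p q : M) (X Y : M -> 'cV[R]_n.*2).

Local Notation hor_lift := (horizontal_lift A proj).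
Local Notation dproj := (diff_proj A proj).
Local Notation s_ := (sym_map A proj).
Local Notation fl t := (flow A lambda t).

Definition vlift X : V -> V := fun x => hlift A proj x (X (proj x)).

Lemma vliftP X : lifts A proj (vlift X) X.
Proof. by move=> x hx; exact: (hliftP hA hA2 hM). Qed.

Lemma horizontal0 x : horizontal A x 0.
Proof. by split; rewrite -(scale0r x) OmegaZl mul0r. Qed.

Lemma dproj0 x : Sigma A x -> dproj x 0 = 0.
Proof.
move=> hx; have := dproj_linear hA hM 1 hx (horizontal0 x) (horizontal0 x).
rewrite !scale1r addr0.
by move=> /eqP; rewrite -subr_eq subrr eq_sym => /eqP.
Qed.

Lemma dprojN x v : Sigma A x -> horizontal A x v -> dproj x (- v) = - dproj x v.
Proof.
move=> hx hv; have := dproj_linear hA hM (-1) hx hv (horizontal0 x).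
by rewrite !scaleN1r addr0 dproj0 // addr0.
Qed.

Lemma vlift0 X x : Sigma A x -> X (proj x) = 0 -> vlift X x = 0.
Proof.
move=> hx X0; have hX := vliftP X hx.
apply: (hor_lift_uniq hA hA2 hM hx hX); rewrite X0.
by split; [exact: horizontal0|exact: dproj0].
Qed.

Lemma diff_map_center p (w : 'cV[R]_n.*2) : diff_map (s_ p) p w = - w.
Proof.
have [hx xp] := orbit_repP hM p; set x := orbit_rep A proj p in hx xp *.
have [v [hv vw]] := hor_lift_exists hA hA2 hM w hx.
have := diff_map_sym_map hA hA2 hM hx hx (horizontal_tangent hA hv).
by rewrite xp vw (sym_mx_x hx) (sym_mx_horizontal hv) dprojN // vw.
Qed.

Lemma vlift_related x X X' y : Sigma A x -> Sigma A y ->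
  vf_related (s_ (proj x)) X X' ->
  vlift X' (sym_mx A x *m y) = sym_mx A x *m vlift X y.
Proof.
move=> hx hy rel; have hSy := sym_mx_Sigma hA hA2 hx hy.
apply: (hor_lift_uniq hA hA2 hM hSy (vliftP X' hSy)).
have [hX dX] := vliftP X hy.
split; first exact: (sym_mx_hor_map hA hA2 hx hX).
rewrite -(diff_map_sym_map hA hA2 hM hx hy (horizontal_tangent hA hX)) dX.
by rewrite -(sym_mapE hA hA2 hM hx hy) rel.
Qed.

Lemma smooth_ext_conj (S : 'M[R]_(n.+1 + n.+1)) (Y Z : V -> V) y F :
  (forall z, Sigma A z -> Sigma A (S *m z)) ->
  (forall z, Sigma A z -> Z z = S *m Y (S *m z)) ->
  smooth_ext (Sigma A) Y (S *m y) F ->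
  smooth_ext (Sigma A) Z y (mulmx S \o (F \o mulmx S)).
Proof.
move=> SS ZY /smooth_extP[sF FY].
have cS : continuous (mulmx S : V -> V) by exact: linear_cV_continuous.
apply/smooth_extP; split.
  have sFS : smoothat (F \o mulmx S) y.
    exact: (@smoothat_comp_linear _ _ _ _ (mulmx S) F y cS sF).
  exact: (smoothat_mulmxl S sFS).
have H : \forall z \near y, Sigma A (S *m z) -> F (S *m z) = Y (S *m z).
  exact: (cS y (fun z => Sigma A z -> F z = Y z)).
apply: filterS H => z H Sz; rewrite /= H; last exact: SS.
by rewrite ZY.
Qed.

(** S_x is linear and involutive: conjugation by it turns an extension of Y' near
    S_x y into an extension of Y near y. *)
Lemma derive_on_related x y v (Y Y' : V -> V) : Sigma A x -> Sigma A y ->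
  tangent_Sigma A y v -> smooth_on (Sigma A) Y' ->
  (forall z, Sigma A z -> Y' (sym_mx A x *m z) = sym_mx A x *m Y z) ->
  derive_on (Sigma A) Y' (sym_mx A x *m y) (sym_mx A x *m v) =
  sym_mx A x *m derive_on (Sigma A) Y y v.
Proof.
move=> hx hy tv sY' YY'; have hSy := sym_mx_Sigma hA hA2 hx hy.
have [F hF] := sY' _ hSy; have [sF _] := (smooth_extP _ _ _ _).1 hF.
rewrite (derive_onE hA hSy (sym_mx_tangent hA hA2 hx tv) hF).
have hG : smooth_ext (Sigma A) Y y (mulmx (sym_mx A x) \o (F \o mulmx (sym_mx A x))).
  apply: smooth_ext_conj hF => z hz; first exact: (sym_mx_Sigma hA hA2 hx hz).
  by rewrite YY' // sym_mxK.
rewrite (derive_onE hA hy tv hG).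
have cS : continuous (mulmx (sym_mx A x) : V -> V) by exact: linear_cV_continuous.
have dFS : derivable (F \o mulmx (sym_mx A x)) y v.
  by rewrite comp_linear_derive; exact: smoothat_derivable.
have [_ ->] := linear_comp_derive cS dFS.
by rewrite comp_linear_derive /= sym_mxK.
Qed.

(** S_x is linear, preserves Omega and commutes with A, so it carries the formula
    for the lift of nabla X Y at y to the formula at S_x y. *)
Lemma reduced_affine nabla p :
  reduced_connection A proj nabla -> affine_diffeo nabla (s_ p).
Proof.
move=> hred X X' Y Y' sX sX' sY sY' rX rY q.
have [hx xp] := orbit_repP hM p; set x := orbit_rep A proj p in hx xp.
have [hy yq] := orbit_repP hM q; set y := orbit_rep A proj q in hy yq.
rewrite -xp in rX rY *; rewrite -yq.
have hSy := sym_mx_Sigma hA hA2 hx hy.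
have h1 := hred X Y _ _ sX sY (vliftP X) (vliftP Y) y hy.
have h2 := hred X' Y' _ _ sX' sY' (vliftP X') (vliftP Y') _ hSy.
have sYL := lift_smooth hA hA2 hM sY' (vliftP Y').
have [hXy _] := vliftP X hy.
rewrite (vlift_related hx hy rX) (vlift_related hx hy rY) in h2.
have dE := derive_on_related hx hy (horizontal_tangent hA hXy) sYL
  (fun z hz => vlift_related hx hz rY).
rewrite dE -!(sym_mx_A hA hA2) !(sym_mx_Omega hx) !scalemxAr -mulmxBr -mulmxDr -[A *m (_ *: y)]scalemxAr in h2.
have [h11 h12] := h1; have [_ h22] := h2.
rewrite (sym_mapE hA hA2 hM hx hy) -h22 -h12.
exact/esym/(diff_map_sym_map hA hA2 hM hx hy (horizontal_tangent hA h11)).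
Qed.

(** The image of X under the symmetry at p, which is its own inverse. *)
Definition push p X : M -> 'cV[R]_n.*2 :=
  fun q => diff_map (s_ p) (s_ p q) (X (s_ p q)).

Lemma push_related p X : vf_related (s_ p) X (push p X).
Proof. by move=> q; rewrite /push (sym_mapK hA hA2 hM). Qed.

Lemma push_center p X : push p X p = - X p.
Proof. by rewrite /push (sym_map_fix hA hA2 hM) diff_map_center. Qed.

(** The lift of the image is S_x o X o S_x, with X lifted. *)
Lemma push_smooth p X : smooth_vf X -> smooth_vf (push p X).
Proof.
move=> sX; have [hx xp] := orbit_repP hM p; set x := orbit_rep A proj p in hx xp.
have SS z (hz : Sigma A z) := sym_mx_Sigma hA hA2 hx hz.
apply: (@descend_vf _ _ _ _ hA hA2 _ _ hM _
   (fun z => sym_mx A x *m vlift X (sym_mx A x *m z))).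
  move=> y hy; have [F hF] := lift_smooth hA hA2 hM sX (vliftP X) (SS y hy).
  exists (mulmx (sym_mx A x) \o (F \o mulmx (sym_mx A x))).
  exact: (smooth_ext_conj SS _ hF).
move=> y hy; have hSy := SS y hy; have [hX dX] := vliftP X hSy.
have := sym_mx_hor_map hA hA2 hx hX; rewrite sym_mxK // => hSX; split => //.
have := diff_map_sym_map hA hA2 hM hx hSy (horizontal_tangent hA hX).
rewrite sym_mxK // => <-; rewrite /push -xp (sym_mapE hA hA2 hM hx hy) dX.
by [].
Qed.

End Canonical.

(** * Tensoriality and uniqueness *)

Section Tensoriality.
Context {R : realType} {n : nat}.
Notation V := 'cV[R]_(n.+1 + n.+1).
Variables (A : 'M[R]_(n.+1 + n.+1)) (lambda : R).
Hypotheses (hA : in_sp A) (hA2 : A *m A = lambda%:M).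
Context {M : smooth_manifold R n.*2}.
Variables (proj : V -> M) (hM : quotient_submersion A proj).
Implicit Types (x v w : V) (p q : M) (X Y : M -> 'cV[R]_n.*2).

Local Notation hor_lift := (horizontal_lift A proj).
Local Notation dproj := (diff_proj A proj).
Local Notation s_ := (sym_map A proj).
Local Notation fl t := (flow A lambda t).

Lemma flow_OmegaE t v w : Omega (fl t *m v) (fl t *m w) = Omega v w.
Proof. by rewrite !flowE (flow_Omega hA hA2) // cosA_sinA. Qed.

Lemma flow_A t v : A *m (fl t *m v) = fl t *m (A *m v).
Proof. by rewrite !flowE mulmxDr -!scalemxAr. Qed.

Lemma horizontal_flow t x v :
  horizontal A x v -> horizontal A (fl t *m x) (fl t *m v).
Proof. by move=> [h1 h2]; split; rewrite ?flow_A flow_OmegaE. Qed.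

Lemma dproj_flow t x v : Sigma A x -> horizontal A x v ->
  dproj (fl t *m x) (fl t *m v) = dproj x v.
Proof.
move=> hx hv; have hfx := flow_Sigma hA hA2 t hx.
have hfv := horizontal_flow t hv.
have [F hF] := proj_ext0 hM hfx; have [sF Ff] := (smooth_extP _ _ _ _).1 hF.
rewrite (diff_projE hA hfx (horizontal_tangent hA hfv) hF).
have cS : continuous (mulmx (fl t) : V -> V) by exact: linear_cV_continuous.
have hG : smooth_ext (Sigma A) (chart (proj x) \o proj) x (F \o mulmx (fl t)).
  apply/smooth_extP; split.
    exact: (@smoothat_comp_linear _ _ _ _ (mulmx (fl t)) F x cS sF).
  rewrite (proj_flow hA hA2 hM t hx) in Ff.
  have H : \forall z \near x, Sigma A (fl t *m z) ->
      F (fl t *m z) = chart (proj x) (proj (fl t *m z)).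
    exact: (cS x (fun z => Sigma A z -> F z = chart (proj x) (proj z))).
  apply: filterS H => z H Sz; rewrite /= (H (flow_Sigma hA hA2 t Sz)).
  by rewrite (proj_flow hA hA2 hM t Sz).
rewrite (diff_projE hA hx (horizontal_tangent hA hv) hG).
by rewrite comp_linear_derive.
Qed.

Lemma vlift_flow X t x : Sigma A x ->
  vlift A proj X (fl t *m x) = fl t *m vlift A proj X x.
Proof.
move=> hx; have hfx := flow_Sigma hA hA2 t hx.
have [h1 h2] := vliftP hA hA2 hM X hx.
apply: (hor_lift_uniq hA hA2 hM hfx (vliftP hA hA2 hM X hfx)); split.
  exact: horizontal_flow.
by rewrite dproj_flow // h2 (proj_flow hA hA2 hM t hx).
Qed.

(** Evaluation at representatives is the descent to M of the functions and of
    the horizontal fields that are invariant under the flow ([desc_funE],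
    [desc_vf_lifts]). *)
Definition desc_fun (phi : V -> R) (q : M) : R := phi (orbit_rep A proj q).
Definition desc_vf (Z : V -> V) (q : M) : 'cV[R]_n.*2 :=
  dproj (orbit_rep A proj q) (Z (orbit_rep A proj q)).

Lemma desc_funE (phi : V -> R) x :
  (forall t y, Sigma A y -> phi (fl t *m y) = phi y) -> Sigma A x ->
  desc_fun phi (proj x) = phi x.
Proof.
move=> inv hx; have [hr er] := orbit_repP hM (proj x); rewrite /desc_fun.
by have [t ->] := (proj_eqP hA2 hM hx hr).1 (esym er); exact: inv.
Qed.

Lemma desc_vf_lifts (Z : V -> V) :
  (forall y, Sigma A y -> horizontal A y (Z y)) ->
  (forall t y, Sigma A y -> Z (fl t *m y) = fl t *m Z y) ->
  lifts A proj Z (desc_vf Z).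
Proof.
move=> hZ eZ x hx; split; first exact: hZ.
have [hr er] := orbit_repP hM (proj x); rewrite /desc_vf.
have [t ->] := (proj_eqP hA2 hM hx hr).1 (esym er).
by rewrite eZ // (dproj_flow t hx (hZ x hx)).
Qed.

Lemma hor_proj_linear x (a : R) v w : hor_proj A x (a *: v + w) = a *: hor_proj A x v + hor_proj A x w.
Proof.
by rewrite /hor_proj !OmegaE; apply/colP => i; rewrite !mxE; ring.
Qed.

Lemma hor_proj_flow t x v : hor_proj A (fl t *m x) (fl t *m v) = fl t *m hor_proj A x v.
Proof.
by rewrite /hor_proj flow_A !flow_OmegaE mulmxDr mulmxBr !scalemxAr.
Qed.

Lemma hor_proj0 x : hor_proj A x 0 = 0.
Proof. by apply: hor_proj_id; exact: horizontal0. Qed.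

Lemma hor_proj_sum x I (r : seq I) (c : I -> R) (Z : I -> V) :
  hor_proj A x (\sum_(i <- r) c i *: Z i) = \sum_(i <- r) c i *: hor_proj A x (Z i).
Proof.
elim: r => [|i r IH]; first by rewrite !big_nil hor_proj0.
by rewrite !big_cons hor_proj_linear IH.
Qed.

Lemma dproj_sum x I (r : seq I) (c : I -> R) (Z : I -> V) : Sigma A x ->
  (forall i, horizontal A x (Z i)) ->
  horizontal A x (\sum_(i <- r) c i *: Z i) /\
  dproj x (\sum_(i <- r) c i *: Z i) = \sum_(i <- r) c i *: dproj x (Z i).
Proof.
move=> hx hZ; elim: r => [|i r [IH1 IH2]].
  by rewrite !big_nil; split; [exact: horizontal0|exact: (dproj0 hA hM hx)].
rewrite !big_cons -IH2 -(dproj_linear hA hM (c i) hx (hZ i) IH1); split=> //.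
have [v1 v2] := hZ i; have [w1 w2] := IH1.
by split; rewrite OmegaDl OmegaZl ?v1 ?v2 ?w1 ?w2 mulr0 addr0.
Qed.

Lemma smoothat_comm_field w u x : smoothat (comm_field A w u) x.
Proof.
have si := smoothat_id x.
have s1 : smoothat (fun y : V => Omega w (A *m y) : R^o) x.
  exact: (smoothat_Omega (smoothat_cst w x) (smoothat_mulmxl A si)).
have s2 : smoothat (fun y : V => Omega w y : R^o) x.
  exact: (smoothat_Omega (smoothat_cst w x) si).
exact: (smoothatD (smoothatZ s1 (smoothat_cst u x)) (smoothatZ s2 (smoothat_cst (A *m u) x))).
Qed.

Lemma smoothat_hor_proj (Z : V -> V) x : smoothat Z x -> smoothat (fun y => hor_proj A y (Z y)) x.
Proof.
move=> sZ; have si := smoothat_id x; have sA := smoothat_mulmxl A si.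
have s1 := smoothatZ (smoothat_Omega sZ sA) si.
have s2 := smoothatZ (smoothat_Omega sZ si) sA.
exact: (smoothatD (smoothatD sZ (smoothatN s1)) s2).
Qed.

(** [comm_field_complete] with w the representative of p, applied to the lift of X,
    projected to the horizontal spaces and then to M. The coefficients and the
    fields are defined globally, as the axioms of a connection require. *)
Lemma frame_decomposition X p : smooth_vf X ->
  exists (g : M -> R) (f : 'I_(n.+1 + n.+1) -> M -> R)
         (E : 'I_(n.+1 + n.+1) -> M -> 'cV[R]_n.*2),
    [/\ smooth_fun g, g p = 1, forall i, smooth_fun (f i), forall i, smooth_vf (E i) &
      (fun q => g q *: X q) = (fun q => \sum_i f i q *: E i q)] /\
    (X p = 0 -> forall i, f i p = 0).
Proof.
move=> sX; have [hx0 px0] := orbit_repP hM p; set x0 := orbit_rep A proj p in hx0 px0.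
pose XL := vlift A proj X.
pose gam x := Omega x0 (A *m x) ^+ 2 - lambda * Omega x0 x ^+ 2.
pose phi i x := Omega (XL x) (comm_field A x0 (- Jmx *m ecol i) x).
pose Z i x := hor_proj A x (comm_field A x0 (ecol i) x).
have Bfl t u y : comm_field A x0 u (fl t *m y) = fl t *m comm_field A x0 u y.
  by rewrite !flowE (comm_field_flow hA2).
have gfl t y : Sigma A y -> gam (fl t *m y) = gam y.
  move=> _; rewrite /gam flow_A !flowE !OmegaE (AA hA2) OmegaZr.
  set a := Omega x0 y; set b := Omega x0 (A *m y).
  have := cosA_sinA lambda t; set c := cosA _ _; set s := sinA _ _ => cs.
  by rewrite -[RHS]mul1r -cs; ring.
have pfl i t y : Sigma A y -> phi i (fl t *m y) = phi i y.
  by move=> hy; rewrite /phi Bfl /XL vlift_flow // flow_OmegaE.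
have Zhor i y : Sigma A y -> horizontal A y (Z i y).
  by move=> hy; exact: hor_proj_horizontal.
have Zfl i t y : Sigma A y -> Z i (fl t *m y) = fl t *m Z i y.
  by move=> _; rewrite /Z Bfl hor_proj_flow.
exists (desc_fun gam), (fun i => desc_fun (phi i)), (fun i => desc_vf (Z i)).
split; last first.
  move=> X0 i; rewrite /desc_fun /phi /XL (vlift0 hA hA2 hM hx0) ?px0 //.
  by rewrite -(scale0r x0) OmegaZl mul0r.
split.
- apply: (descend_fun hA hA2 hM (phi := gam)); last by move=> x hx; exact: desc_funE.
  move=> x hx; exists gam; apply: smoothat_smooth_ext.
  have si := smoothat_id x.
  have s1 := smoothat_Omega (smoothat_cst x0 x) (smoothat_mulmxl A si).
  have s2 := smoothat_Omega (smoothat_cst x0 x) si.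
  have -> : gam = (fun y => Omega x0 (A *m y) * Omega x0 (A *m y) : R^o)
      + (fun y => (- lambda) * (Omega x0 y * Omega x0 y) : R^o).
    by apply/funext => y; rewrite /gam !expr2 -mulNr.
  exact: (smoothatD (smoothatM s1 s1)
    (smoothatM (smoothat_cst (- lambda : R^o) x) (smoothatM s2 s2))).
- rewrite /desc_fun /gam -/x0 (hx0 : Omega x0 (A *m x0) = 1) Omegaxx; ring.
- move=> i; apply: (descend_fun hA hA2 hM (phi := phi i)); last first.
    by move=> x hx; apply: desc_funE => //; exact: pfl.
  move=> x hx; have [F /smooth_extP[sF FX]] := lift_smooth hA hA2 hM sX (vliftP hA hA2 hM X) hx.
  exists (fun y => Omega (F y) (comm_field A x0 (- Jmx *m ecol i) y)).
  apply/smooth_extP; split.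
    exact: (smoothat_Omega sF (smoothat_comm_field _ _ _)).
  by apply: filterS FX => y H Sy; rewrite H.
- move=> i; apply: (descend_vf hA hA2 hM (X' := Z i)).
    move=> x hx; exists (Z i); apply: smoothat_smooth_ext.
    exact: (smoothat_hor_proj (smoothat_comm_field _ _ _)).
  by apply: desc_vf_lifts; [exact: Zhor|exact: Zfl].
apply/funext => q; rewrite /desc_fun /desc_vf.
have [hx xq] := orbit_repP hM q; move: hx xq; set x := orbit_rep A proj q => hx xq.
have [h1 h2] := vliftP hA hA2 hM X hx; rewrite xq in h2.
have [_ <-] := dproj_sum (index_enum _) (phi ^~ x) hx (fun i => Zhor i x hx).
rewrite /Z -hor_proj_sum (comm_field_complete hA hA2 x0 x (XL x)) -/(gam x).
have := dproj_linear hA hM (gam x) hx h1 (horizontal0 A x).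
rewrite (dproj0 hA hM hx) !addr0 h2 => <-.
congr (dproj x _); apply/esym/hor_proj_id.
have [h11 h12] := h1.
by split; rewrite OmegaZl ?h11 ?h12 mulr0.
Qed.

(** g X with g p = 1 is a combination of fields with coefficients that vanish at
    p. *)
Lemma connection_tensor_left nabla X Y p : is_connection nabla ->
  smooth_vf X -> smooth_vf Y -> X p = 0 -> nabla X Y p = 0.
Proof.
move=> hn sX sY X0.
have [g [f [E [[sg g1 sf sE e] f0]]]] := frame_decomposition p sX.
have [_ _ hZ _ _] := hn.
have := hZ g X Y sg sX sY p; rewrite g1 scale1r => <-; rewrite e.
rewrite (connection_suml hn sf sE _ p sY); apply: big1 => i _.
by rewrite f0 // scale0r.
Qed.

(** In the Leibniz rule applied to the decomposition of g Y, the terms that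
    differentiate the coefficients do not involve the connection. *)
Lemma connection_tensor_right nabla nabla' X Y p : is_connection nabla ->
  is_connection nabla' -> smooth_vf X -> smooth_vf Y -> Y p = 0 ->
  nabla' X Y p = nabla X Y p.
Proof.
move=> hn hn' sX sY Y0.
have [g [f [E [[sg g1 sf sE e] f0]]]] := frame_decomposition p sY.
have key nab : is_connection nab ->
    nab X Y p = \sum_i vf_apply X (f i) p *: E i p.
  move=> hnab; have [_ _ _ _ hZ] := hnab.
  have := hZ g X Y sg sX sY p; rewrite Y0 scaler0 add0r g1 scale1r => <-; rewrite e.
  rewrite (connection_sumr hnab sf sE _ p sX); apply: eq_bigr => i _.
  by rewrite f0 // scale0r addr0.
by rewrite !key.
Qed.

(** Let T be the difference of the two connections at p, and X', Y' the images of
    X, Y under the symmetry at p, whose differential there is minus the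
    identity. By invariance T (X', Y') = - T (X, Y). As T is a tensor and X', Y'
    take opposite values to X, Y at p, also T (X', Y') = T (X, Y). So T = 0. *)
Lemma canonical_unique nabla nabla' X Y p : is_connection nabla ->
  is_connection nabla' -> affine_diffeo nabla (s_ p) -> affine_diffeo nabla' (s_ p) ->
  smooth_vf X -> smooth_vf Y -> nabla' X Y p = nabla X Y p.
Proof.
move=> hn hn' an an' sX sY.
pose X' := push A proj p X; pose Y' := push A proj p Y.
have sX' : smooth_vf X' by exact: (push_smooth hA hA2 hM).
have sY' : smooth_vf Y' by exact: (push_smooth hA hA2 hM).
have X'p : X p + X' p = 0 by rewrite /X' (push_center hA hA2 hM) subrr.
have Y'p : Y p + Y' p = 0 by rewrite /Y' (push_center hA hA2 hM) subrr.
have odd_left nab : is_connection nab -> nab X' Y' p = - nab X Y' p.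
  move=> hnab; have [_ hD _ _ _] := hnab.
  have := hD X X' Y' sX sX' sY' p.
  rewrite (connection_tensor_left hnab (smooth_vfD sX sX') sY' X'p).
  by move=> /esym /eqP; rewrite addrC addr_eq0 => /eqP.
have odd_right : nabla' X Y' p - nabla X Y' p = - (nabla' X Y p - nabla X Y p).
  have := connection_tensor_right hn hn' sX (smooth_vfD sY sY') Y'p.
  have [_ _ _ hD _] := hn; have [_ _ _ hD' _] := hn'.
  rewrite (hD X Y Y' sX sY sY' p) (hD' X Y Y' sX sY sY' p) => H.
  apply/eqP; rewrite -subr_eq0 opprK; apply/eqP.
  by apply/colP => i; move/colP: H => /(_ i); rewrite !mxE => H; lra.
have aff nab : affine_diffeo nab (s_ p) -> nab X' Y' p = - nab X Y p.
  move=> anab; have := anab X X' Y Y' sX sX' sY sY'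
    (push_related hA hA2 hM p X) (push_related hA hA2 hM p Y) p.
  by rewrite (sym_map_fix hA hA2 hM) (diff_map_center hA hA2 hM).
have H1 := odd_left _ hn; have H2 := odd_left _ hn'.
rewrite (aff _ an) in H1; rewrite (aff _ an') in H2.
move/oppr_inj: H1 => H1; move/oppr_inj: H2 => H2; rewrite -H1 -H2 in odd_right.
apply/eqP; rewrite -subr_eq0; apply/eqP.
by apply/colP => i; move/colP: odd_right => /(_ i); rewrite !mxE => H; lra.
Qed.

End Tensoriality.

Theorem proposition7p3 (R : realType) (n : nat) (hn : (2 <= n)%N)
    (A : 'M[R]_(n.+1 + n.+1)) (lambda : R)
    (hA0 : A <> 0) (hA : in_sp A) (hA2 : A *m A = lambda%:M)
    (hSigma : Sigma A !=set0)
    (M : smooth_manifold R n.*2)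
    (proj : 'cV[R]_(n.+1 + n.+1) -> M) (hM : quotient_submersion A proj)
    (omega : M -> 'cV[R]_n.*2 -> 'cV[R]_n.*2 -> R)
    (homega : is_symplectic_form omega) (homega_red : reduced_form A proj omega)
    (nabla : (M -> 'cV[R]_n.*2) -> (M -> 'cV[R]_n.*2) -> (M -> 'cV[R]_n.*2))
    (hnabla : is_connection nabla)
    (hnabla_red : reduced_connection A proj nabla) :
  exists s : M -> M -> M,
    symmetric_symplectic_space omega s /\
    canonical_symmetric_connection s nabla.
Proof.
have affine p : affine_diffeo nabla (sym_map A proj p).
  exact: (reduced_affine hA hA2 hM (p := p) hnabla_red).
exists (sym_map A proj); split; split => //.
- split.
  + exact: (sym_map_family hA hA2 hM).
  + by move=> p; exact: (sym_map_symplectic hA hA2 hM).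
  + exact: (sym_mapK hA hA2 hM).
  + move=> p; split; first exact: (sym_map_fix hA hA2 hM).
    exact: (sym_map_isolated hA hA2 hM).
  + exact: (sym_map_conj hA hA2 hM).
- move=> nabla' hnabla' affine' X Y sX sY p.
  exact: (canonical_unique hA hA2 hM hnabla hnabla' (affine p) (affine' p) sX sY).
Qed.
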